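(* Let the model and Assumptions (A1)--(A4) of the context hold, let $\Theta\subset\mathbb{R}^p$, and assume that the true parameter $\theta^*$ is $s$-sparse (at most $s$ nonzero components, $1\le s\le p$) and belongs to $\Theta$. Let $0<\varepsilon<1$, $1\le q\le\infty$, $\lambda\in[1/2,2]$, and set $\mu=\delta_1'(\varepsilon)+\delta_4'(\varepsilon)+\delta_5(\varepsilon)+b(\varepsilon)$ and $\tau=\delta_2(\varepsilon)+\delta_3(\varepsilon)$. Let $(\hat\theta,\hat t)$ be a solution of the conic programming problem in the context. Assume that $$\kappa_q(s,1+\lambda)\ge c\,s^{-1/q}$$ for some constant $c>0$, and that $$s\le c_1(\lambda^{-1}+\lambda)^{-1}\sqrt{n/\log(p/\varepsilon)}$$ for some small enough constant $c_1>0$. Then each of the following two bounds holds with probability at least $1-8\varepsilon$: $$|\hat\theta-\theta^*|_q\le C s^{1/q}\sqrt{\frac{\log(c'p/\varepsilon)}{n}}\,\big(|\theta^*|_2+1\big)$$ (with $s^{1/\infty}=1$), and $$\frac1n\big|X(\hat\theta-\theta^* )\big|_2^2\le C s\,\frac{\log(c'p/\varepsilon)}{n}\,\big(|\theta^*|_2+1\big)^2 .$$ Here the constants $C>0$, $c'>0$, and the smallness threshold for $c_1$, depend only on $m_2,\sigma,\sigma_*,c_b,c_b'$ and $c$ (not on $n,p,s,\varepsilon,\theta^*$).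
   Context: Notation: $|\cdot|_q$ is the $\ell_q$-norm of vectors, $1\le q\le\infty$; for a matrix, $|\cdot|_\infty$ is the largest absolute value of its entries. A random variable $\eta$ is $\gamma$-subgaussian (subgaussian with variance parameter $\gamma^2$) if $\mathbb{E}[\exp(t\eta)]\le\exp(\gamma^2t^2/2)$ for all $t\in\mathbb{R}$; a random vector $\zeta\in\mathbb{R}^p$ is $\gamma$-subgaussian if $(\zeta,v)$ is $\gamma$-subgaussian for every $v$ with $|v|_2=1$. For a square matrix $A$, $\mathrm{Diag}\{A\}$ keeps the diagonal of $A$ and sets the off-diagonal elements to zero. Model: $y=X\theta^*+\xi$, $Z=X+W$, where $y\in\mathbb{R}^n$ and the $n\times p$ matrix $Z$ are observed, the $n\times p$ matrix $X=(X_{ij})$ is unknown, $W=(W_{ij})$ is an $n\times p$ random noise matrix, $\xi\in\mathbb{R}^n$ is a random noise vector, and $\theta^*\in\mathbb{R}^p$ is unknown. Set $\Psi=\frac1nX^TX$, $m_2=\max_{j}\frac1n\sum_{i=1}^nX_{ij}^2$, $\sigma_j^2=\frac1n\sum_{i=1}^n\mathbb{E}(W_{ij}^2)$, and let $D$ be the diagonal matrix with diagonal entries $\sigma_j^2$. Assumptions. (A1) $X$ is deterministic. (A2) The elements of $\xi$ are independent zero-mean subgaussian with variance parameter $\sigma^2$. (A3) The rows $w_1,\dots,w_n$ of $W$ are independent zero-mean subgaussian random vectors with variance parameter $\sigma_*^2$, $\mathbb{E}(W_{ij}W_{ik})=0$ for all $1\le j<k\le p$, and $W$ is independent of $\xi$.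 (A4) There are statistics $\hat\sigma_j^2$ such that for any $\varepsilon>0$, $\mathbb{P}[\max_{j}|\hat\sigma_j^2-\sigma_j^2|\ge b(\varepsilon)]\le\varepsilon$, where $b(\varepsilon)=c_b\sqrt{\log(c_b'p/\varepsilon)/n}$ for constants $c_b,c_b'>0$ (it is understood that $b(\varepsilon)$ is well defined, i.e. $c_b'p/\varepsilon\ge1$, for the $\varepsilon$ considered). Let $\widehat D$ be the diagonal matrix with entries $\hat\sigma_j^2$. Noise levels: $\delta_2(\varepsilon)=\sigma\sqrt{2m_2\log(2p/\varepsilon)/n}$; $\delta_3(\varepsilon)=\delta_5(\varepsilon)=\max\big(\gamma_0\sqrt{2\log(2p/\varepsilon)/n},\ 2\log(2p/\varepsilon)/(t_0n)\big)$; $\delta_4(\varepsilon)=\max\big(\gamma_0\sqrt{2\log(p(p-1)/\varepsilon)/n},\ 2\log(p(p-1)/\varepsilon)/(t_0n)\big)$; $\delta_1'(\varepsilon)=\sigma_*\sqrt{2m_2\log(2p/\varepsilon)/n}$; $\delta_4'(\varepsilon)=\max\big(\gamma_2\sqrt{2\log(2p/\varepsilon)/n},\ 2\log(2p/\varepsilon)/(t_2n)\big)$. Here $\gamma_0,t_0>0$ depend only on $\sigma,\sigma_*$ and $\gamma_2,t_2>0$ depend only on $\sigma_*$; they are constants such that, under (A1)--(A3), each of the following inequalities holds with probability at least $1-\varepsilon$: $|\frac1nW^T\xi|_\infty\le\delta_3(\varepsilon)$, $|\frac1n(W^TW-\mathrm{Diag}\{W^TW\})|_\infty\le\delta_4(\varepsilon)$,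 $|\frac1n\mathrm{Diag}\{W^TW\}-D|_\infty\le\delta_5(\varepsilon)$, $|\frac1n(W^TW-\mathrm{Diag}\{W^TW\})\theta^*|_\infty\le\delta_4'(\varepsilon)|\theta^*|_2$. Conic programming estimator: $\hat\theta$ is the first component of a solution $(\hat\theta,\hat t)$ of: minimise $|\theta|_1+\lambda t$ over $(\theta,t)$ such that $\theta\in\Theta$, $t\in\mathbb{R}^+=[0,\infty)$, $\big|\frac1nZ^T(y-Z\theta)+\widehat D\theta\big|_\infty\le\mu t+\tau$, $|\theta|_2\le t$. (A minimiser is understood to exist when the feasible set is nonempty; otherwise $(\hat\theta,\hat t)$ is arbitrary.) Sensitivity: for $J\subset\{1,\dots,p\}$, $\Delta_J$ is the vector with the coordinates of $\Delta$ on $J$ and zeros elsewhere; $C_J(u)=\{\Delta\in\mathbb{R}^p:|\Delta_{J^c}|_1\le u|\Delta_J|_1\}$; $\kappa_q(s,u)=\min_{J:|J|\le s}\min_{\Delta\in C_J(u):|\Delta|_q=1}|\Psi\Delta|_\infty$ (a minimum over the empty set is $+\infty$). *)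

(* Defs.v *)
From HB Require Import structures.
From mathcomp Require Import all_boot all_order all_algebra.
From mathcomp Require Import all_classical all_reals all_analysis.
Set Implicit Arguments.
Unset Strict Implicit.
Unset Printing Implicit Defensive.
Import Order.TTheory GRing.Theory Num.Theory.
Import numFieldNormedType.Exports.
Local Open Scope classical_set_scope.
Local Open Scope ring_scope.

(** Conventions: vectors of R^p are column vectors; for a matrix or vector [A],
    [`|A|] is the library norm, i.e. the largest absolute value of the entries.
    A random matrix is a family [W] of real random variables, [W i j] being its
    [(i, j)] entry. *)

Section Norms.
Context {R : realType} {p : nat}.
Implicit Types (v Delta : 'cV[R]_p) (J : {set 'I_p}).

(** The value at [-oo] is irrelevant: only [1 <= q] is used. *)
Definition lq_norm (q : \bar R) v : R :=
  match q with
  | r%:E => (\sum_(j < p) `|v j 0| `^ r) `^ r^-1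
  | +oo%E => `|v|
  | -oo%E => 0
  end.

(** Since [+oo^-1 = 0] in [\bar R], [x `^ inv_exponent +oo = x `^ 0 = 1]. *)
Definition inv_exponent (q : \bar R) : R := fine (q^-1)%E.

Definition sparse (s : nat) v : Prop := (#|[pred j | (v j 0 != 0)%R]| <= s)%N.

Definition restrict J v : 'cV[R]_p := \col_j (if j \in J then v j 0 else 0).

Definition cone J (u : R) : set 'cV[R]_p :=
  [set Delta | lq_norm 1%:E (restrict (~: J)%SET Delta)
               <= u * lq_norm 1%:E (restrict J Delta)].

(** The inner infimum is over a compact set, hence it is a minimum whenever that
    set is nonempty; [ereal_inf set0 = +oo]. *)
Definition sensitivity (Psi : 'M[R]_p) (q : \bar R) (s : nat) (u : R) : \bar R :=
  ereal_inf [set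
    ereal_inf [set `|Psi *m Delta|%:E
              | Delta in [set Delta | cone J u Delta /\ lq_norm q Delta = 1]]
  | J in [set J : {set 'I_p} | (#|J| <= s)%N]].

Definition diag_part (A : 'M[R]_p) : 'M[R]_p := diag_mx (\row_j A j j).

End Norms.

Section Design.
Context {R : realType} {n p : nat}.

Definition gram (X : 'M[R]_(n, p)) : 'M[R]_p := n%:R^-1 *: (X^T *m X).

Definition max_col_mean_square (X : 'M[R]_(n, p)) : R :=
  \big[Num.max/0]_(j < p) (n%:R^-1 * \sum_(i < n) X i j ^+ 2).

End Design.

Section Probability.
Context {d : measure_display} {T : measurableType d} {R : realType}.
Variable P : probability T R.

(** "[A] has probability at least [r]", for events [A] that may depend on a
    selection (a minimiser) not known to be measurable; when [A] is measurable
    this is [r%:E <= P A]. *)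
Definition prob_at_least (r : R) (A : set T) : Prop :=
  exists B : set T, [/\ measurable B, B `<=` A & (r%:E <= P B)%E].

Definition subgaussian (gamma : R) (eta : T -> R) : Prop :=
  forall t : R, ('M_P eta t <= (expR (gamma ^+ 2 * t ^+ 2 / 2))%:E)%E.

Definition subgaussian_vector (p : nat) (gamma : R) (zeta : 'I_p -> T -> R) :=
  forall v : 'cV[R]_p, lq_norm 2%:E v = 1 ->
    subgaussian gamma (fun w => \sum_(j < p) zeta j w * v j 0).

(** The sigma-algebra generated by the family [X], hence by a random vector when
    [X] lists its coordinates. *)
Definition sigma_algebra_of (I : Type) (X : I -> T -> R) : set (set T) :=
  <<s \bigcup_(i in [set: I]) g_sigma_algebra_preimage (X i) >>.

Definition mutually_independent (I : finType) (F : I -> set (set T)) : Prop :=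
  forall (J : {set I}) (A : I -> set T), (forall i, i \in J -> F i (A i)) ->
    P (\bigcap_(i in [set i | i \in J]) A i) = (\prod_(i in J) P (A i))%E.

Definition independent2 (F G : set (set T)) : Prop :=
  forall A B : set T, F A -> G B -> P (A `&` B) = (P A * P B)%E.

End Probability.

Section Noise.
Context {d : measure_display} {T : measurableType d} {R : realType}.
Context {P : probability T R} {n p : nat}.
Implicit Types (W : 'I_n -> 'I_p -> {RV P >-> R}) (xi : 'I_n -> {RV P >-> R}).

Definition mx_at W (w : T) : 'M[R]_(n, p) := \matrix_(i, j) W i j w.

Definition vec_at xi (w : T) : 'cV[R]_n := \col_i xi i w.

Definition regression_noise (sigma : R) xi : Prop :=
  [/\ mutually_independent P (fun i => sigma_algebra_of (fun _ : unit => xi i)),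
      forall i, ('E_P[xi i] = 0)%E
    & forall i, subgaussian P sigma (xi i)].

Definition design_noise (sigmas : R) W xi : Prop :=
  [/\ mutually_independent P (fun i => sigma_algebra_of (W i)),
      forall i j, ('E_P[W i j] = 0)%E,
      forall i, subgaussian_vector P sigmas (W i),
      forall i (j k : 'I_p), (j < k)%N -> ('E_P[W i j \* W i k] = 0)%E
    & independent2 P
        (sigma_algebra_of (fun ij : 'I_n * 'I_p => W ij.1 ij.2))
        (sigma_algebra_of xi)].

(** The expectations are finite for subgaussian noise. *)
Definition noise_variance W (j : 'I_p) : R :=
  n%:R^-1 * \sum_(i < n) fine ('E_P[fun w => (W i j w ^+ 2)%R])%E.

End Noise.

Section Levels.
Context {R : realType}.
Variables (n p : nat).

Definition b_level (cb cb' eps : R) : R :=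
  cb * Num.sqrt (ln (cb' * p%:R / eps) / n%:R).

(** [b_level] is meaningful only if its logarithm is nonnegative, whence the
    guard. The statistics are arbitrary random variables on the sample space:
    they may be computed from data other than [(y, Z)]. *)
Definition variance_statistics d (T : measurableType d) (P : probability T R)
    (cb cb' : R) (W : 'I_n -> 'I_p -> {RV P >-> R})
    (hsigma2 : 'I_p -> {RV P >-> R}) : Prop :=
  forall eps : R, 0 < eps -> 1 <= cb' * p%:R / eps ->
    (P [set w | (b_level cb cb' eps <=
         \big[Num.max/0]_(j < p) `|hsigma2 j w - noise_variance W j|)%R]
     <= eps%:E)%E.

Definition subexp_level (gamma t L : R) : R :=
  Num.max (gamma * Num.sqrt (2 * L / n%:R)) (2 * L / (t * n%:R)).

Definition delta1' (sigmas m2 eps : R) : R :=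
  sigmas * Num.sqrt (2 * m2 * ln (2 * p%:R / eps) / n%:R).

Definition delta2 (sigma m2 eps : R) : R :=
  sigma * Num.sqrt (2 * m2 * ln (2 * p%:R / eps) / n%:R).

Definition delta3 (gamma0 t0 eps : R) : R :=
  subexp_level gamma0 t0 (ln (2 * p%:R / eps)).

(** For [p = 1] the argument of [ln] is [0] and [ln 0 = 0]; the matrix bounded
    by this level is then [0]. *)
Definition delta4 (gamma0 t0 eps : R) : R :=
  subexp_level gamma0 t0 (ln (p%:R * (p%:R - 1) / eps)).

Definition delta4' (gamma2 t2 eps : R) : R :=
  subexp_level gamma2 t2 (ln (2 * p%:R / eps)).

Definition delta5 (gamma0 t0 eps : R) : R := delta3 gamma0 t0 eps.

End Levels.

(** The constants [gamma0], [t0] are functions of [(sigma, sigmas)], and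
    [gamma2], [t2] are functions of [sigmas]; they do not depend on the model. *)
Definition noise_constants (R : realType) (gamma0 t0 : R -> R -> R)
    (gamma2 t2 : R -> R) : Prop :=
  forall sigma sigmas : R, 0 <= sigma -> 0 <= sigmas ->
  [/\ 0 < gamma0 sigma sigmas, 0 < t0 sigma sigmas,
      0 < gamma2 sigmas, 0 < t2 sigmas &
  forall (d : measure_display) (T : measurableType d) (P : probability T R)
    (n p : nat) (W : 'I_n -> 'I_p -> {RV P >-> R}) (xi : 'I_n -> {RV P >-> R})
    (theta : 'cV[R]_p) (eps : R),
  (0 < n)%N -> (0 < p)%N -> 0 < eps < 1 ->
  regression_noise sigma xi -> design_noise sigmas W xi ->
  let WW w := (mx_at W w)^T *m mx_at W w in
  let g0 := gamma0 sigma sigmas in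
  let s0 := t0 sigma sigmas in
  [/\ prob_at_least P (1 - eps) [set w |
        `|n%:R^-1 *: ((mx_at W w)^T *m vec_at xi w)| <= delta3 n p g0 s0 eps],
      prob_at_least P (1 - eps) [set w |
        `|n%:R^-1 *: (WW w - diag_part (WW w))| <= delta4 n p g0 s0 eps],
      prob_at_least P (1 - eps) [set w |
        `|n%:R^-1 *: diag_part (WW w) - diag_mx (\row_j noise_variance W j)|
          <= delta5 n p g0 s0 eps]
    & prob_at_least P (1 - eps) [set w |
        `|n%:R^-1 *: ((WW w - diag_part (WW w)) *m theta)|
          <= delta4' n p (gamma2 sigmas) (t2 sigmas) eps * lq_norm 2%:E theta]]].

Section ConicProgram.
Context {R : realType} {n p : nat}.
Variables (Theta : set 'cV[R]_p) (Z : 'M[R]_(n, p)) (y : 'cV[R]_n).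
Variables (hD : 'M[R]_p) (mu tau lambda : R).

Definition conic_feasible (theta : 'cV[R]_p) (t : R) : Prop :=
  [/\ Theta theta, 0 <= t,
      `|n%:R^-1 *: (Z^T *m (y - Z *m theta)) + hD *m theta| <= mu * t + tau
    & lq_norm 2%:E theta <= t].

(** No constraint is put on the output when the program is infeasible. *)
Definition conic_solution (htheta : 'cV[R]_p) (ht : R) : Prop :=
  (exists theta t, conic_feasible theta t) ->
  conic_feasible htheta ht /\
  forall theta t, conic_feasible theta t ->
    lq_norm 1%:E htheta + lambda * ht <= lq_norm 1%:E theta + lambda * t.

End ConicProgram.

(* Main.v *)
Require Import Defs.
From HB Require Import structures.
From mathcomp Require Import all_boot all_order all_algebra.
From mathcomp Require Import all_classical all_reals all_analysis.
From mathcomp Require Import measurable_realfun ring lra.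
Set Implicit Arguments.
Unset Strict Implicit.
Unset Printing Implicit Defensive.
Import Order.TTheory GRing.Theory Num.Theory.
Import numFieldNormedType.Exports.
Local Open Scope classical_set_scope.
Local Open Scope ring_scope.

(** Write [Delta] for the estimation error, [Psi] for the Gram matrix, [N] for
    the Euclidean norm of the true parameter [theta], and put
    [L = ln (p / eps)], [r = sqrt (L / n)].

    On an event of probability at least [1 - 8 * eps] eight quantities are
    small at once: the four noise terms controlled by the constants
    [gamma0, t0, gamma2, t2], the error of the variance statistics, and the
    averages [X^T xi / n], [X^T W theta / n], [X^T W / n].  The last three are
    linear in independent subgaussian variables: the moment generating function
    of a weighted sum of independent variables is the product of the individual
    ones ([expectation_prod_independent], [subgaussian_sum]), Chernoff's bound
    gives the tail ([subgaussian_tail]), and a union bound over the coordinates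
    finishes ([subgaussian_maximal]).

    On this event the rest is deterministic.  The pair [(theta, N)] is feasible
    ([true_parameter_feasible]), so the minimiser does at least as well, and
    comparing the two objective values puts [Delta] in the cone of the support
    of [theta] with aperture [1 + lambda] and controls the second component of
    the minimiser ([support_cone]).  Both [theta] and the minimiser nearly solve
    the same noisy linear system, so [Psi Delta] is small up to a multiple of
    [r * |Delta|_1] ([gram_norm_le]).  The sensitivity turns [Psi Delta] into
    the [lq] norm of [Delta], the cone condition and Hoelder's inequality turn
    [|Delta|_1] into the same norm, and the bound on the sparsity makes the
    remainder at most half of the main term, so that it can be absorbed
    ([sensitivity_absorption]).  The prediction error follows from
    [Delta^T Psi Delta <= |Delta|_1 * |Psi Delta|].

    All noise levels are at most a constant times [r]: when [eps <= 1/8] one has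
    [L >= 1], which absorbs the constants inside the logarithms, and the bound
    on [s] forces [r <= 1], so that the branch of order [r ^+ 2] in the
    subexponential levels is also of order [r].  When [eps > 1/8] the claimed
    probability is negative and the empty event will do. *)

(** * Independence and subgaussian tails *)

Section Independence.
Local Open Scope ereal_scope.
Context {d : measure_display} {T : measurableType d} {R : realType}.
Variable P : probability T R.
Import HBNNSimple.

(** Both sides are additive in [phi] and continuous along increasing sequences,
    so it is enough that they agree on indicators: [phi] is the increasing limit
    of simple functions.  Finiteness of [K] makes multiplication by [K]
    continuous. *)
Lemma ge0_integral_comp_mul (eta g : T -> R) (phi : R -> R) (K : \bar R) :
  measurable_fun setT eta -> measurable_fun setT g -> (forall x, 0 <= g x)%R ->
  K \is a fin_num ->
  (forall B, measurable B ->
     \int[P]_x (\1_B (eta x) * g x)%:E = \int[P]_x (\1_B (eta x))%:E * K) ->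
  measurable_fun setT phi -> (forall x, 0 <= phi x)%R ->
  \int[P]_x (phi (eta x) * g x)%:E = \int[P]_x (phi (eta x))%:E * K.
Proof.
move=> meta mg g0 Kfin indE mphi phi0.
have mephi : measurable_fun setT (fun y : R => (phi y)%:E).
  exact/measurable_EFinP.
pose h := nnsfun_approx measurableT mephi.
have mh n : measurable_fun setT (fun x => h n (eta x)).
  by apply: measurableT_comp.
have hnd x : {homo (fun n => h n (eta x)) : m n / (m <= n)%N >-> (m <= n)%R}.
  by move=> m n mn; exact/lefP/nd_nnsfun_approx.
have hcvg x : (h n (eta x))%:E @[n --> \oo] --> (phi (eta x))%:E.
  by apply: (cvg_nnsfun_approx measurableT mephi) => // y _; rewrite lee_fin.
have cvg1 : \int[P]_x (h n (eta x))%:E @[n --> \oo]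
    --> \int[P]_x (phi (eta x))%:E.
  rewrite (eq_integral (fun x => limn (fun n => (h n (eta x))%:E))); last first.
    by move=> x _; apply/esym/cvg_lim.
  apply: cvg_monotone_convergence => //.
  - by move=> n; exact/measurable_EFinP.
  - by move=> n x _; rewrite lee_fin.
  - by move=> x _ m n mn; rewrite lee_fin; exact: hnd.
have cvg2 : \int[P]_x (h n (eta x) * g x)%:E @[n --> \oo]
    --> \int[P]_x (phi (eta x) * g x)%:E.
  rewrite (eq_integral
    (fun x => limn (fun n => (h n (eta x) * g x)%:E))); last first.
    move=> x _; apply/esym/cvg_lim => //; rewrite EFinM.
    by under eq_fun do rewrite EFinM; apply: cvgeZr.
  apply: cvg_monotone_convergence => //.
  - by move=> n; apply/measurable_EFinP; exact: measurable_funM.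
  - by move=> n x _; rewrite lee_fin mulr_ge0.
  - by move=> x _ m n mn; rewrite lee_fin ler_wpM2r//; exact: hnd.
have eqn n : \int[P]_x (h n (eta x) * g x)%:E = \int[P]_x (h n (eta x))%:E * K.
  have mB y : measurable (h n @^-1` [set y]) by exact: measurable_funPTI.
  have mI y :
      measurable_fun setT (fun x => \1_(h n @^-1` [set y]) (eta x) : R)%R.
    exact: measurableT_comp.
  have y0 y x : (0 <= y * \1_(h n @^-1` [set y]) (eta x))%R.
    by have := nnfun_muleindic_ge0 (h n) y (eta x); rewrite lee_fin.
  have E1 : \int[P]_x (h n (eta x))%:E = \sum_(y \in range (h n))
      \int[P]_x (y * \1_(h n @^-1` [set y]) (eta x))%:E.
    rewrite -ge0_integral_fsum//; last 2 first.
    - by move=> y; apply/measurable_EFinP; apply: measurable_funM.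
    - by move=> y x _; rewrite lee_fin.
    - by apply: eq_integral => x _; rewrite (fimfunE (h n)) -fsumEFin.
  have E2 : \int[P]_x (h n (eta x) * g x)%:E = \sum_(y \in range (h n))
      \int[P]_x (y * (\1_(h n @^-1` [set y]) (eta x) * g x))%:E.
    rewrite -ge0_integral_fsum//; last 2 first.
    - move=> y; apply/measurable_EFinP; apply: measurable_funM => //.
      exact: measurable_funM.
    - by move=> y x _; rewrite mulrA lee_fin mulr_ge0.
    - apply: eq_integral => x _; rewrite EFinM (fimfunE (h n)) -fsumEFin//.
      rewrite ge0_mule_fsuml; last by move=> y; rewrite lee_fin.
      by apply: eq_fsbigr => y _; rewrite mulrA.
  rewrite E1 E2 ge0_mule_fsuml; last first.
    by move=> y; apply: integral_ge0 => x _; rewrite lee_fin.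
  apply: eq_fsbigr => y; rewrite inE => -[z _ hz].
  have y0' : (0 <= y)%R by rewrite -hz.
  under eq_integral do rewrite EFinM.
  rewrite ge0_integralZl//; last 2 first.
  - by apply/measurable_EFinP; exact: measurable_funM.
  - by move=> x _; rewrite lee_fin mulr_ge0.
  under [in RHS]eq_integral do rewrite EFinM.
  rewrite [in RHS]ge0_integralZl//; last first.
  - exact/measurable_EFinP.
  by rewrite indE// muleA.
apply: (cvg_unique _ cvg2) => //.
rewrite (_ : (fun n => _) = (fun n => \int[P]_x (h n (eta x))%:E * K)).
  exact: cvgeZr.
exact/funext.
Qed.

Definition independent_functions (I : finType) (eta : I -> T -> R) : Prop :=
  forall (J : {set I}) (B : I -> set R), (forall i, measurable (B i)) ->
    P (\bigcap_(i in [set i | i \in J]) (eta i @^-1` B i))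
    = \prod_(i in J) P (eta i @^-1` B i).

Lemma integral_indic_comp (f : T -> R) (B : set R) :
  measurable_fun setT f -> measurable B ->
  \int[P]_x (\1_B (f x))%:E = P (f @^-1` B).
Proof.
move=> mf mB; rewrite -[f @^-1` B in RHS]setIT -integral_indic//.
by rewrite -[X in measurable X]setTI; exact: mf.
Qed.

(** Induction on the set of indices [i] for which [phi i] is arbitrary, the
    others being indicators.  When all are indicators the formula is the
    independence of the events; freeing one more index is
    [ge0_integral_comp_mul], whose hypothesis on indicators is the induction
    hypothesis with [phi i] replaced by an indicator. *)
Lemma expectation_prod_independent (I : finType) (eta : I -> T -> R)
    (phi : I -> R -> R) :
  (forall i, measurable_fun setT (eta i)) -> independent_functions eta ->
  (forall i, measurable_fun setT (phi i)) -> (forall i x, 0 <= phi i x)%R ->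
  (forall i, \int[P]_x (phi i (eta i x))%:E \is a fin_num) ->
  \int[P]_x (\prod_i phi i (eta i x))%:E =
  \prod_i \int[P]_x (phi i (eta i x))%:E.
Proof.
move=> meta ind.
have : forall i, i \notin enum I ->
    exists2 B : set R, measurable B & phi i = \1_B.
  by move=> i; rewrite mem_enum.
elim: (enum I) phi => [|i s IH] phi indic mphi phi0 phifin.
  have /choice[B BE] : forall i, exists B : set R, measurable B /\ phi i = \1_B.
    by move=> i; have [//|B mB E] := indic i; exists B.
  have mB i : measurable (B i) by have [] := BE i.
  have phiE i : phi i = \1_(B i) by have [] := BE i.
  transitivity (\int[P]_x
      (\1_(\bigcap_(i in [set i | i \in [set: I]%SET])
             (eta i @^-1` B i)) x)%:E).
    apply: eq_integral => x _; congr (_%:E).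
    rewrite indicE; case: (boolP (x \in _)) => [|].
      rewrite inE => xB; rewrite big1// => i _; rewrite phiE indicE mem_set//.
      by apply: xB; rewrite /= finset.inE.
    rewrite notin_setE => xB.
    have [i Bi] : exists i, ~ B i (eta i x).
      by apply/existsNP => xB'; apply: xB => i _; exact: xB'.
    by rewrite (bigD1 i)//= phiE indicE memNset// mul0r.
  rewrite integral_indic// ?setIT; last first.
    apply: fin_bigcap_measurable => [|i _]; first exact: finite_finset.
    by rewrite -[X in measurable X]setTI; exact: meta.
  apply: etrans (ind [set: I]%SET B mB) _.
  apply: eq_big => [i|i _]; first by rewrite finset.inE.
  by rewrite phiE integral_indic_comp.
transitivity (\int[P]_x
    (phi i (eta i x) * \prod_(k | k != i) phi k (eta k x))%:E).
  by apply: eq_integral => x _; rewrite (bigD1 i).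
rewrite [RHS](bigD1 i)//=; apply: ge0_integral_comp_mul => //.
- under eq_fun do rewrite -big_filter.
  by apply: measurable_prod => k _; exact: measurableT_comp.
- by move=> x; apply: prodr_ge0.
- by apply: prode_fin_num => k _.
- move=> B mB; pose phi' k := if k == i then \1_B : R -> R else phi k.
  have phi'i : phi' i = \1_B by rewrite /phi' eqxx.
  have phi'k k : k != i -> phi' k = phi k by rewrite /phi' => /negbTE ->.
  have := IH phi'; rewrite (bigD1 i)//= phi'i.
  under [X in _ * X]eq_bigr => k ki do rewrite phi'k//.
  move=> <-.
  + apply: eq_integral => x _; rewrite [in RHS](bigD1 i)//= phi'i.
    by under [in RHS]eq_bigr => k ki do rewrite phi'k//.
  + move=> k ks; have [->|ki] := eqVneq k i; first by exists B.
    by rewrite phi'k//; apply: indic; rewrite inE negb_or ki.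
  + by move=> k; have [->|/phi'k ->//] := eqVneq k i; rewrite phi'i.
  + by move=> k x; have [->|/phi'k ->//] := eqVneq k i; rewrite phi'i.
  + move=> k; have [->|/phi'k ->//] := eqVneq k i; rewrite phi'i.
    rewrite integral_indic_comp// fin_num_measure//.
    by rewrite -[X in measurable X]setTI; exact: meta.
Qed.

(** By independence the moment generating function of the sum is the product of
    those of the terms, and the exponents add up. *)
Lemma subgaussian_sum (I : finType) (eta : I -> T -> R) (a : I -> R)
    (gamma V : R) :
  (forall i, measurable_fun setT (eta i)) -> independent_functions eta ->
  (forall i, subgaussian P gamma (eta i)) ->
  (\sum_i a i ^+ 2 <= V)%R ->
  subgaussian P (gamma * Num.sqrt V) (fun x => \sum_i a i * eta i x)%R.
Proof.
move=> meta ind sub aV t.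
have mgfE i : \int[P]_x (expR (t * a i * eta i x))%:E = 'M_P (eta i) (t * a i).
  rewrite /mmt_gen_fun unlock; apply: eq_integral => x _ /=.
  by rewrite mulrC.
have mgf_le i : 'M_P (eta i) (t * a i) <=
    (expR (gamma ^+ 2 * (t * a i) ^+ 2 / 2))%:E by exact: sub.
have mgf_ge0 i : 0 <= 'M_P (eta i) (t * a i).
  by rewrite -mgfE; apply: integral_ge0 => x _; rewrite lee_fin expR_ge0.
have -> : 'M_P (fun x => \sum_i a i * eta i x)%R t =
    \prod_i \int[P]_x (expR (t * a i * eta i x))%:E.
  rewrite -(@expectation_prod_independent _ _
    (fun i y => expR (t * a i * y)))//.
  - rewrite /mmt_gen_fun unlock; apply: eq_integral => x _ /=.
    rewrite mulr_suml expR_sum; congr (_%:E); apply: eq_bigr => i _.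
    by rewrite mulrC mulrA.
  - by move=> i; apply: measurableT_comp => //; exact: measurable_funM.
  - move=> i; rewrite mgfE ge0_fin_numE ?mgf_ge0//.
    by rewrite (le_lt_trans (mgf_le i)) ?ltry.
apply: (@le_trans _ _ (\prod_i (expR (gamma ^+ 2 * (t * a i) ^+ 2 / 2))%:E)).
  suff [] : 0 <= \prod_i \int[P]_x (expR (t * a i * eta i x))%:E /\
      \prod_i \int[P]_x (expR (t * a i * eta i x))%:E <=
      \prod_i (expR (gamma ^+ 2 * (t * a i) ^+ 2 / 2))%:E by [].
  apply: (big_ind2 (fun x y : \bar R => 0 <= x /\ x <= y))
    => [|x1 x2 y1 y2|i _].
  - by rewrite lee01.
  - by move=> [x0 x12] [y0 y12]; rewrite mule_ge0// lee_pmul.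
  - by rewrite mgfE.
rewrite prodEFin -expR_sum lee_fin ler_expR -mulr_suml ler_pM2r ?invr_gt0//.
have V0 : (0 <= V)%R.
  by rewrite (le_trans _ aV)// sumr_ge0// => i _; rewrite sqr_ge0.
rewrite exprMn sqr_sqrtr// -mulrA -mulr_sumr ler_wpM2l ?sqr_ge0//.
by under eq_bigr do rewrite exprMn; rewrite -mulr_sumr mulrC ler_wpM2r ?sqr_ge0.
Qed.

Lemma subgaussian_scale (gamma a : R) (eta : T -> R) :
  subgaussian P gamma eta -> subgaussian P (gamma * a) (fun x => a * eta x)%R.
Proof.
move=> sub t.
have -> : 'M_P (fun x => a * eta x)%R t = 'M_P eta (t * a).
  rewrite /mmt_gen_fun; congr ('E_P[_]); apply/funext => x /=.
  by congr expR; ring.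
have -> : ((gamma * a) ^+ 2 * t ^+ 2 = gamma ^+ 2 * (t * a) ^+ 2)%R by ring.
exact: sub.
Qed.

(** The optimal parameter in Chernoff's bound is [u / gamma] with
    [u = sqrt (2 * L)], which makes no sense for [gamma = 0].  The bound is
    therefore applied with every [g > gamma] in place of [gamma], and [g] then
    decreases to [gamma]: this is why the inequality in the event is strict. *)
Lemma subgaussian_tail (gamma L : R) (eta : T -> R) :
  (0 <= gamma)%R -> (0 < L)%R -> measurable_fun setT eta ->
  subgaussian P gamma eta ->
  P [set x | (gamma * Num.sqrt (2 * L) < eta x)%R] <= (expR (- L))%:E.
Proof.
move=> gamma0 L0 meta sub.
set u := Num.sqrt (2 * L); have u0 : (0 < u)%R by rewrite sqrtr_gt0 mulr_gt0.
pose etaRV : {RV P >-> R} := HB.pack_for {RV P >-> R} eta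
  (isMeasurableFun.Build _ _ _ _ _ meta).
have chern g : (0 < g)%R -> (gamma <= g)%R ->
    P [set x | (g * u <= eta x)%R] <= (expR (- L))%:E.
  move=> g0 gg; have ug : (0 < u / g)%R by rewrite divr_gt0.
  apply: le_trans (chernoff etaRV (g * u)%R ug) _.
  have /(lee_wpmul2r _)-/(_ (expR (- (u / g * (g * u))))%:E) := sub (u / g)%R.
  rewrite lee_fin expR_ge0 => /(_ isT) /le_trans; apply.
  rewrite -EFinM -expRD lee_fin ler_expR.
  have u2 : (u ^+ 2 = 2 * L)%R by rewrite sqr_sqrtr// mulr_ge0// ltW.
  have -> : (u / g * (g * u) = u ^+ 2)%R by field; rewrite gt_eqF.
  have -> : (gamma ^+ 2 * (u / g) ^+ 2 / 2 = (gamma / g) ^+ 2 * (u ^+ 2 / 2))%R.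
    by field; rewrite gt_eqF.
  rewrite u2 (mulrC 2%R) mulfK//.
  have : ((gamma / g) ^+ 2 <= 1)%R.
    by rewrite expr_le1 ?divr_ge0 ?(ltW g0)// ler_pdivrMr// mul1r.
  move/(ler_wpM2r (ltW L0)); rewrite mul1r => h.
  by rewrite lerBlDr (le_trans h)//; lra.
pose F k := [set x | ((gamma + k.+1%:R^-1) * u <= eta x)%R].
have mF k : measurable (F k).
  by rewrite -[F k]setTI; exact: measurable_fun_le.
have FE : [set x | (gamma * u < eta x)%R] = \bigcup_k F k.
  apply/seteqP; split=> [x /= lt|x [k _]]; last first.
    by rewrite /F/=; apply: lt_le_trans; rewrite ltr_pM2r// ltrDl invr_gt0.
  have d0 : (0 < eta x / u - gamma)%R by rewrite subr_gt0 ltr_pdivlMr.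
  have [k kd] : exists k, (k.+1%:R^-1 < eta x / u - gamma)%R.
    have [k _ /(_ k (leqnn k)) ?] := near_infty_natSinv_lt (PosNum d0).
    by exists k.
  by exists k => //; rewrite /F/= -ler_pdivlMr// -lerBrDl ltW.
rewrite FE; have ndF : nondecreasing_seq F.
  move=> m n mn; apply/subsetPset => x; rewrite /F/=; apply: le_trans.
  by rewrite ler_pM2r// lerD2l lef_pV2 ?posrE ?ler_nat.
have cvgF := @nondecreasing_cvg_mu _ _ _ P _ mF
  (bigcup_measurable (fun k _ => mF k)) ndF.
rewrite -(cvg_lim (@ereal_hausdorff R) cvgF).
apply: lime_le; first exact: cvgP cvgF.
apply: nearW => k; apply: chern; last by rewrite lerDl.
by rewrite ltr_wpDl// invr_gt0.
Qed.

Lemma mutually_independent_functions (I : finType) (F : I -> set (set T))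
    (eta : I -> T -> R) :
  mutually_independent P F ->
  (forall i B, measurable B -> F i (eta i @^-1` B)) ->
  independent_functions eta.
Proof.
by move=> ind Feta J B mB; apply: ind => i _; exact: Feta.
Qed.

(** The combination is measurable on the sample space equipped with the
    generated sigma-algebra, since each [X i] is. *)
Lemma sigma_algebra_of_lincomb (I : finType) (X : I -> T -> R) (v : I -> R) B :
  measurable B -> sigma_algebra_of X ((fun w => \sum_i X i w * v i)%R @^-1` B).
Proof.
move=> mB.
pose G := \bigcup_(i in [set: I]) g_sigma_algebra_preimage (X i).
have mX i : measurable_fun setT (X i : g_sigma_algebraType G -> R).
  move=> _ C mC; apply: sub_gen_smallest; exists i => //; by exists C.
have mS : measurable_fun setT
    ((fun w => \sum_i X i w * v i)%R : g_sigma_algebraType G -> R).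
  by apply: measurable_sum => i; exact: measurable_funM.
by have := mS measurableT B mB; rewrite setTI.
Qed.

(** In terms of exceptional sets, the failure probabilities simply add up. *)
Lemma prob_at_leastP (r : R) (A : set T) :
  prob_at_least P (1 - r) A <->
  exists N, [/\ measurable N, ~` A `<=` N & P N <= r%:E].
Proof.
split=> [[B [mB BA PB]]|[N [mN AN PN]]]; [exists (~` B)|exists (~` N)]; split.
- exact: measurableC.
- exact: subsetC.
- rewrite probability_setC// leeBlDl ?fin_num_measure//.
  by move: PB; rewrite EFinB leeBlDr.
- exact: measurableC.
- by rewrite -[A]setCK; exact: subsetC.
- by rewrite probability_setC// EFinB; apply: leeB.
Qed.

Lemma prob_at_leastI (r1 r2 : R) (A1 A2 : set T) :
  prob_at_least P (1 - r1) A1 -> prob_at_least P (1 - r2) A2 ->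
  prob_at_least P (1 - (r1 + r2)) (A1 `&` A2).
Proof.
move=> /prob_at_leastP[N1 [mN1 AN1 PN1]] /prob_at_leastP[N2 [mN2 AN2 PN2]].
apply/prob_at_leastP; exists (N1 `|` N2); split.
- exact: measurableU.
- by rewrite setCI; exact: setUSS.
- by apply: le_trans (measureU2 _ mN1 mN2) _; rewrite EFinD; exact: leeD.
Qed.

Lemma prob_at_leastS (r : R) (A1 A2 : set T) : A1 `<=` A2 ->
  prob_at_least P r A1 -> prob_at_least P r A2.
Proof.
move=> A12 [B [mB BA PB]]; exists B; split=> //; exact: subset_trans A12.
Qed.

Lemma prob_at_least_le0 (r : R) (A : set T) : (r <= 0)%R -> prob_at_least P r A.
Proof. by move=> r0; exists set0; split=> //; rewrite measure0 lee_fin. Qed.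

Lemma measurable_gt_set (f : T -> R) (a : R) :
  measurable_fun setT f -> measurable [set w | (a < f w)%R].
Proof.
move=> mf; rewrite (_ : [set w | _] = ~` [set w | (f w <= a)%R]); last first.
  by apply/seteqP; split=> w /=; rewrite ltNge => /negP.
apply: measurableC; rewrite -[X in measurable X]setTI.
exact: measurable_fun_le.
Qed.

(** Union bound over the two tails of each of the [#|I|] variables; the level is
    the one at which each tail has probability at most [eps / (2 * #|I|)]. *)
Lemma subgaussian_maximal (I : finType) (eta : I -> T -> R) (gamma eps : R) :
  (0 < #|I|)%N -> (0 < eps < 1)%R -> (0 <= gamma)%R ->
  (forall i, measurable_fun setT (eta i)) ->
  (forall i, subgaussian P gamma (eta i)) ->
  prob_at_least P (1 - eps) [set w | forall i,
    (`|eta i w| <= gamma * Num.sqrt (2 * ln (2 * #|I|%:R / eps)))%R].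
Proof.
move=> I0 /andP[eps0 eps1] gamma0 meta sub; set L := ln _.
have q0 : (0 < 2 * #|I|%:R / eps)%R by rewrite !mulr_gt0 ?invr_gt0 ?ltr0n.
have L0 : (0 < L)%R.
  rewrite ln_gt0// ltr_pdivlMr// mul1r (lt_le_trans eps1)//.
  by rewrite -natrM (ler_nat _ 1) muln_gt0.
pose up i := [set w | (gamma * Num.sqrt (2 * L) < eta i w)%R].
pose lo i := [set w | (gamma * Num.sqrt (2 * L) < (- eta i w))%R].
have mN i : measurable_fun setT (fun w => - eta i w)%R.
  exact: measurableT_comp.
have mup i : measurable (up i) by exact: measurable_gt_set.
have mlo i : measurable (lo i) by exact: measurable_gt_set.
have subN i : subgaussian P gamma (fun w => - eta i w)%R.
  have := @subgaussian_scale gamma (-1)%R _ (sub i).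
  under [X in subgaussian _ _ X]eq_fun do rewrite mulN1r.
  by move=> s t; have := s t; rewrite mulrN1 sqrrN.
apply/prob_at_leastP; exists (\bigcup_(i in [set: I]) (up i `|` lo i)).
have mU i : measurable (up i `|` lo i) by exact: measurableU.
split; first by apply: fin_bigcup_measurable => //; exact: finite_finset.
- move=> w /= /existsNP[i /negP]; rewrite -ltNge => etai; exists i => //.
  by move: etai; rewrite ltr_normr => /orP[]; [left|right].
- have mUU : measurable (\bigcup_(i in [set: I]) (up i `|` lo i)).
    by apply: fin_bigcup_measurable => //; exact: finite_finset.
  apply: le_trans (content_sub_fsum (D := setT)
    (A_ := fun i => up i `|` lo i) P _ _ mUU _) _ => //.
    exact: finite_finset.
  rewrite (_ : [set: I] = [set` enum I]); last first.
    by apply/seteqP; split=> i _ //=; rewrite mem_enum.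
  rewrite -fsbig_seq ?enum_uniq//= big_enum/=.
  apply: le_trans (_ : \sum_(i : I) (2 * expR (- L))%:E <= _); last first.
    rewrite sumEFin lee_fin sumr_const -mulr_natl expRN lnK ?posrE//.
    rewrite le_eqVlt; apply/orP; left; apply/eqP.
    by field; rewrite pnatr_eq0 -lt0n I0 gt_eqF.
  apply: lee_sum => i _; apply: le_trans (measureU2 _ (mup i) (mlo i)) _.
  have -> : (2 * expR (- L) = expR (- L) + expR (- L))%R by ring.
  by rewrite EFinD; apply: leeD; exact: subgaussian_tail.
Qed.

End Independence.

(** * Norms of vectors and matrices *)

Section VectorNorms.
Context {R : realType}.

Lemma mx_norm_le (m n : nat) (A : 'M[R]_(m, n)) (x : R) : 0 <= x ->
  (forall i j, `|A i j| <= x) -> `|A| <= x.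
Proof.
move=> x0 Ax; rewrite [leLHS]/Num.Def.normr/= mx_normrE.
by apply: bigmax_le => // -[i j] _; exact: Ax.
Qed.

Lemma ler_mx_norm (m n : nat) (A : 'M[R]_(m, n)) i j : `|A i j| <= `|A|.
Proof.
rewrite [leRHS]/Num.Def.normr/= mx_normrE.
exact: (le_bigmax _ (fun ij : 'I_m * 'I_n => `|A ij.1 ij.2|) (i, j)).
Qed.

Context {p : nat}.
Implicit Types v : 'cV[R]_p.

Lemma lq_norm1E v : lq_norm 1%:E v = \sum_j `|v j 0|.
Proof.
rewrite /lq_norm invr1 powRr1; last by apply: sumr_ge0 => j _; exact: powR_ge0.
by apply: eq_bigr => j _; rewrite powRr1.
Qed.

Lemma lq_norm2E v : lq_norm 2%:E v = Num.sqrt (\sum_j v j 0 ^+ 2).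
Proof.
rewrite /lq_norm powR12_sqrt; last by apply: sumr_ge0 => j _; exact: powR_ge0.
congr Num.sqrt; apply: eq_bigr => j _.
by rewrite powR_mulrn// real_normK// num_real.
Qed.

Lemma lq_norm_ge0 q v : 0 <= lq_norm q v.
Proof. by case: q => [r| |] //=; exact: powR_ge0. Qed.

Lemma lq_normZ q a v : (1 <= q)%E -> lq_norm q (a *: v) = `|a| * lq_norm q v.
Proof.
case: q => [r| |] //= r1; last by rewrite mx_normZ.
have r0 : 0 < r by rewrite (lt_le_trans ltr01)// -lee_fin.
under eq_bigr do rewrite mxE normrM powRM//.
rewrite -mulr_sumr powRM ?powR_ge0//; last first.
  by apply: sumr_ge0 => j _; exact: powR_ge0.
by rewrite -powRrM divff ?gt_eqF// powRr1.
Qed.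

Lemma lq_norm_eq0 q v : (1 <= q)%E -> lq_norm q v = 0 -> v = 0.
Proof.
case: q => [r| |] //= r1; last by move/normr0_eq0.
have r0 : 0 < r by rewrite (lt_le_trans ltr01)// -lee_fin.
move=> /eqP; rewrite powR_eq0 invr_eq0 (gt_eqF r0) andbT psumr_eq0; last first.
  by move=> j _; exact: powR_ge0.
move=> /allP v0; apply/matrixP => j k; rewrite ord1 mxE; apply/eqP.
have /implyP/(_ isT) := v0 j (mem_index_enum j).
by rewrite powR_eq0 normr_eq0 => /andP[].
Qed.

(** Hoelder's inequality against the indicator of [J].  For finite [q = r] and
    [a = s `^ (- 1 / r) * |v|_r], Young's inequality
    [t <= t `^ r / r + (1 - 1 / r)] at [t = |v_j| / a] is summed over [J]: the
    powers sum to at most [s], and so does the right-hand side. *)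
Lemma sum_normr_le_lq_norm (J : {set 'I_p}) (s : nat) q v :
  (1 <= q)%E -> (0 < s)%N -> (#|J| <= s)%N ->
  \sum_(j in J) `|v j 0| <= s%:R * s%:R `^ (- inv_exponent q) * lq_norm q v.
Proof.
move=> q1 s0 Js; have sR : 0 < s%:R :> R by rewrite ltr0n.
have card_le (x : R) : 0 <= x -> x *+ #|J| <= s%:R * x.
  by move=> x0; rewrite -[leLHS]mulr_natl ler_wpM2r// ler_nat.
case: q q1 => [r| |] //; last first.
  move=> _; rewrite /inv_exponent /= oppr0 powRr0 mulr1.
  apply: le_trans (card_le _ (normr_ge0 v)); rewrite -sumr_const.
  by apply: ler_sum => j _; exact: ler_mx_norm.
rewrite lee_fin => r1; have r0 : 0 < r by exact: lt_le_trans r1.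
have [v0|v_neq0] := eqVneq (lq_norm r%:E v) 0.
  rewrite v0 mulr0; have -> := lq_norm_eq0 _ v0; last by rewrite lee_fin.
  by rewrite big1// => j _; rewrite mxE normr0.
have N0 : 0 < lq_norm r%:E v by rewrite lt_def v_neq0 lq_norm_ge0.
have -> : inv_exponent r%:E = r^-1 :> R.
  by rewrite /inv_exponent inver gt_eqF.
set a := s%:R `^ (- r^-1) * lq_norm r%:E v.
have a0 : 0 < a by rewrite mulr_gt0// powR_gt0.
rewrite -mulrA -/a.
have bern j : `|v j 0| / a <= (`|v j 0| / a) `^ r / r + (1 - r^-1).
  have [->|r_neq1] := eqVneq r 1.
    by rewrite powRr1 ?divr_ge0 ?(ltW a0)// invr1 mulr1 subrr addr0.
  have r_gt1 : 1 < r by rewrite lt_def r_neq1.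
  have e0 : 0 < 1 - r^-1 by rewrite subr_gt0 invf_lt1.
  have := @conjugate_powR R (`|v j 0| / a) 1 r (1 - r^-1)^-1.
  rewrite mulr1 powR1 div1r invrK; apply => //.
  - by rewrite divr_ge0// ltW.
  - by rewrite invr_gt0.
  - by rewrite addrC subrK.
have sum_le : \sum_(j in J) (`|v j 0| / a) `^ r <= s%:R.
  apply: le_trans (_ : \sum_j (`|v j 0| / a) `^ r <= _).
    rewrite [leRHS](bigID (mem J))/= lerDl.
    by apply: sumr_ge0 => j _; exact: powR_ge0.
  have ainv : 0 <= a^-1 by rewrite invr_ge0 ltW.
  under eq_bigr do rewrite powRM//.
  rewrite -mulr_suml; have Nr : lq_norm r%:E v `^ r = \sum_j `|v j 0| `^ r.
    rewrite /lq_norm -powRrM mulVf ?gt_eqF// powRr1//.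
    by apply: sumr_ge0 => j _; exact: powR_ge0.
  rewrite -Nr -powRM ?(ltW N0)// /a invfM mulrCA divff// mulr1 -powRN opprK.
  by rewrite -powRrM mulVf ?gt_eqF// powRr1// ltW.
rewrite -ler_pdivrMr// mulr_suml.
apply: le_trans (_ : \sum_(j in J) ((`|v j 0| / a) `^ r / r + (1 - r^-1)) <= _).
  by apply: ler_sum => j _; exact: bern.
rewrite big_split/= -mulr_suml sumr_const.
apply: le_trans (_ : s%:R / r + s%:R * (1 - r^-1) <= _); last first.
  by rewrite mulrBr mulr1 addrC subrK.
apply: lerD; first by rewrite ler_wpM2r// invr_ge0 ltW.
by apply: card_le; rewrite subr_ge0 invf_le1.
Qed.

(** The quadratic [A - 2 t C + t^2 B] in [t] is nonnegative, being a sum of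
    squares; [t = C / B] gives the claim. If [B = 0] the quadratic is
    affine, and it would be negative at a suitable [t] if [C] were positive. *)
Lemma cauchy_schwarz (I : finType) (a b : I -> R) :
  \sum_i a i * b i <= Num.sqrt (\sum_i a i ^+ 2) * Num.sqrt (\sum_i b i ^+ 2).
Proof.
set A := \sum_i a i ^+ 2; set B := \sum_i b i ^+ 2; set C := \sum_i a i * b i.
have A0 : 0 <= A by apply: sumr_ge0 => i _; exact: sqr_ge0.
have B0 : 0 <= B by apply: sumr_ge0 => i _; exact: sqr_ge0.
rewrite -sqrtrM//; have [C0|C0] := leP C 0; first by rewrite (le_trans C0).
rewrite -[leLHS](ger0_norm (ltW C0)) -sqrtr_sqr ler_wsqrtr//.
have quad t : 0 <= A - 2 * t * C + t ^+ 2 * B.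
  have -> : A - 2 * t * C + t ^+ 2 * B = \sum_i (a i - t * b i) ^+ 2.
    rewrite /A /B /C !mulr_sumr -sumrB -big_split/=.
    by apply: eq_bigr => i _; ring.
  by apply: sumr_ge0 => i _; exact: sqr_ge0.
have [B_eq0|B_neq0] := eqVneq B 0.
  have := quad ((A + 1) / C); rewrite B_eq0.
  have -> : A - 2 * ((A + 1) / C) * C + ((A + 1) / C) ^+ 2 * 0 = - A - 2.
    by field; rewrite gt_eqF.
  by move=> h; lra.
have Bp : 0 < B by rewrite lt_def B_neq0.
have := quad (C / B).
have -> : A - 2 * (C / B) * C + (C / B) ^+ 2 * B = (A * B - C ^+ 2) / B.
  by field.
by rewrite pmulr_lge0 ?invr_gt0// subr_ge0.
Qed.

(** Only the coordinates in the support of [u] matter: the square of [|u|_2] is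
    the inner product of [u] and [v] minus that of [u] and [v - u];
    Cauchy-Schwarz bounds the first term, and [|u_j| <= |u|_2] the second. *)
Lemma lq_norm2_sub_le (J : {set 'I_p}) (u v : 'cV[R]_p) :
  (forall j, j \notin J -> u j 0 = 0) ->
  lq_norm 2%:E u - lq_norm 2%:E v <= \sum_(j in J) `|v j 0 - u j 0|.
Proof.
move=> uJ; set N := lq_norm 2%:E u.
have D0 : 0 <= \sum_(j in J) `|v j 0 - u j 0| by apply: sumr_ge0.
have [N0|N_neq0] := eqVneq N 0.
  by rewrite N0 sub0r (le_trans _ D0)// oppr_le0 lq_norm_ge0.
have Np : 0 < N by rewrite lt_def N_neq0 lq_norm_ge0.
have NN : N * N = \sum_j u j 0 * v j 0 - \sum_(j in J) u j 0 * (v j 0 - u j 0).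
  rewrite -expr2 /N lq_norm2E sqr_sqrtr; last first.
    by apply: sumr_ge0 => j _; exact: sqr_ge0.
  rewrite (_ : \sum_(j in J) _ = \sum_j u j 0 * (v j 0 - u j 0)).
    by rewrite -sumrB; apply: eq_bigr => j _; ring.
  rewrite [RHS](bigID (mem J))/= [X in _ + X]big1 ?addr0// => j jJ.
  by rewrite uJ// mul0r.
rewrite -(ler_pM2l Np) mulrBr lerBlDr [leRHS]addrC.
apply: (@le_trans _ _
    (\sum_j u j 0 * v j 0 - \sum_(j in J) u j 0 * (v j 0 - u j 0))).
  by rewrite -NN.
apply: lerD; first by rewrite /N !lq_norm2E cauchy_schwarz.
have uN j : `|u j 0| <= N.
  rewrite /N lq_norm2E -sqrtr_sqr ler_wsqrtr// (bigD1 j)//= lerDl.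
  by apply: sumr_ge0 => k _; exact: sqr_ge0.
rewrite -sumrN mulr_sumr; apply: ler_sum => j _.
by apply: le_trans (ler_norm _) _; rewrite normrN normrM ler_wpM2r.
Qed.

Lemma mx_norm_le_lq_norm2 v : `|v| <= lq_norm 2%:E v.
Proof.
apply: mx_norm_le => [|j k]; first exact: lq_norm_ge0.
rewrite ord1 lq_norm2E -sqrtr_sqr ler_wsqrtr// (bigD1 j)//= lerDl.
by apply: sumr_ge0 => k' _; exact: sqr_ge0.
Qed.

Lemma mx_norm_mulmx_le (m : nat) (A : 'M[R]_(m, p)) v :
  `|A *m v| <= `|A| * lq_norm 1%:E v.
Proof.
apply: mx_norm_le => [|i k]; first by rewrite mulr_ge0// lq_norm_ge0.
rewrite ord1 mxE lq_norm1E mulr_sumr; apply: le_trans (ler_norm_sum _ _ _) _.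
by apply: ler_sum => j _; rewrite normrM ler_wpM2r// ler_mx_norm.
Qed.

Lemma diag_mx_norm_le (d : 'rV[R]_p) v :
  `|diag_mx d *m v| <= `|diag_mx d| * `|v|.
Proof.
apply: mx_norm_le => [|j k]; first by rewrite mulr_ge0.
rewrite mul_diag_mx mxE normrM ler_pM// ?ler_mx_norm//.
by have := ler_mx_norm (diag_mx d) j j; rewrite mxE eqxx mulr1n.
Qed.

End VectorNorms.

(** * Simultaneous bounds on the noise *)

Section NoiseBounds.
Context {d : measure_display} {T : measurableType d} {R : realType}.
Variable P : probability T R.
Context {n p : nat}.
Variable X : 'M[R]_(n, p).
Hypothesis p0 : (0 < p)%N.
Variable eps : R.
Hypothesis eps01 : 0 < eps < 1.

Local Notation m2 := (max_col_mean_square X).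

Lemma max_col_mean_square_ge0 : 0 <= m2.
Proof. exact: bigmax_ge_id. Qed.

Lemma column_weights_le j : \sum_i (n%:R^-1 * X i j) ^+ 2 <= m2 / n%:R.
Proof.
have -> : \sum_i (n%:R^-1 * X i j) ^+ 2 = n%:R^-1 * (\sum_i X i j ^+ 2) / n%:R.
  by rewrite mulr_sumr mulr_suml; apply: eq_bigr => i _; ring.
rewrite ler_wpM2r ?invr_ge0//.
exact: (le_bigmax _ (fun j => n%:R^-1 * \sum_(i < n) X i j ^+ 2) j).
Qed.

(** The weights [X i j / n] of the column averages have sum of squares at most
    [m2 / n]. The finite type [K] indexes several noise vectors to be
    averaged at once. *)
Lemma subgaussian_average_maximal (K : finType) (zeta : K -> 'I_n -> T -> R)
    (gamma : R) :
  (0 < #|K|)%N -> 0 <= gamma ->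
  (forall k i, measurable_fun setT (zeta k i)) ->
  (forall k, independent_functions P (zeta k)) ->
  (forall k i, subgaussian P gamma (zeta k i)) ->
  prob_at_least P (1 - eps) [set w | forall j k,
    `|n%:R^-1 * \sum_i X i j * zeta k i w| <=
    gamma * Num.sqrt (2 * m2 * ln (2 * (p * #|K|)%:R / eps) / n%:R)].
Proof.
move=> K0 gamma0 mzeta ind sub.
pose eta (jk : 'I_p * K) w := \sum_i n%:R^-1 * X i jk.1 * zeta jk.2 i w.
have m20 : 0 <= m2 / n%:R by rewrite divr_ge0// max_col_mean_square_ge0.
have := @subgaussian_maximal _ _ _ P _ eta (gamma * Num.sqrt (m2 / n%:R)) eps.
rewrite card_prod card_ord => H; apply: prob_at_leastS (H _ eps01 _ _ _).
- move=> w /= bound j k; have := bound (j, k).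
  rewrite /eta /= mulr_sumr; under eq_bigr do rewrite -mulrA.
  move=> /le_trans; apply; rewrite -mulrA -sqrtrM//.
  by rewrite le_eqVlt; apply/orP; left; apply/eqP; congr (_ * Num.sqrt _); ring.
- by rewrite muln_gt0 p0.
- by rewrite mulr_ge0// sqrtr_ge0.
- by move=> jk; apply: measurable_sum => i; exact: measurable_funM.
- move=> [j k]; apply: subgaussian_sum => //; exact: column_weights_le.
Qed.

Variable W : 'I_n -> 'I_p -> {RV P >-> R}.
Variable xi : 'I_n -> {RV P >-> R}.
Variables sigma sigmas : R.
Hypotheses (sigma0 : 0 <= sigma) (sigmas0 : 0 <= sigmas).

Lemma design_response_noise_bound : regression_noise sigma xi ->
  prob_at_least P (1 - eps) [set w |
    `|n%:R^-1 *: (X^T *m vec_at xi w)| <= delta2 n p sigma m2 eps].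
Proof.
move=> [ind _ sub].
have := @subgaussian_average_maximal unit (fun _ i => xi i) sigma.
rewrite card_unit muln1 => H; apply: prob_at_leastS (H _ _ _ _ _) => //.
- move=> w /= bound; apply: mx_norm_le => [|j k].
    by rewrite /delta2 mulr_ge0// sqrtr_ge0.
  have := bound j tt; rewrite !mxE /delta2; congr (`|_ * _| <= _).
  by apply: eq_bigr => i _; rewrite !mxE.
- move=> _; apply: (mutually_independent_functions ind) => i B mB.
  by apply: sub_gen_smallest; exists tt => //; exists B => //; rewrite setTI.
Qed.

(** Unit vectors are covered by definition, and the others by homogeneity,
    except [v = 0], for which the combination vanishes. *)
Lemma subgaussian_vector_lincomb (gamma : R) (k : nat) (zeta : 'I_k -> T -> R)
    (v : 'cV[R]_k) :
  subgaussian_vector P gamma zeta ->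
  subgaussian P (gamma * lq_norm 2%:E v) (fun w => \sum_l zeta l w * v l 0).
Proof.
move=> sub; have q2 : (1 <= (2 : R)%:E)%E by rewrite lee_fin ler1n.
have [N0|N_neq0] := eqVneq (lq_norm 2%:E v) 0.
  rewrite N0 (lq_norm_eq0 q2 N0) => t.
  rewrite /mmt_gen_fun (_ : _ \o _ = cst 1); last first.
    apply/funext => w /=; rewrite big1 ?mul0r ?expR0// => l _.
    by rewrite mxE mulr0.
  by rewrite expectation_cst lee_fin mulr0 expr0n/= !mul0r expR0.
have Np : 0 < lq_norm 2%:E v by rewrite lt_def N_neq0 lq_norm_ge0.
pose u := (lq_norm 2%:E v)^-1 *: v.
have u1 : lq_norm 2%:E u = 1.
  by rewrite lq_normZ// ger0_norm ?invr_ge0 ?(ltW Np)// mulVf.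
have := subgaussian_scale (lq_norm 2%:E v) (sub u u1).
rewrite (_ : (fun x => _) = (fun w => \sum_l zeta l w * v l 0))//.
apply/funext => w; rewrite mulr_sumr; apply: eq_bigr => l _.
by rewrite mxE; field.
Qed.

Hypothesis noise : design_noise sigmas W xi.

(** The rows of [W] are independent, hence so are the variables [(W v)_i]. *)
Lemma design_noise_maximal (K : finType) (v : K -> 'cV[R]_p) (V : R) :
  (0 < #|K|)%N -> (forall k, lq_norm 2%:E (v k) = V) ->
  prob_at_least P (1 - eps) [set w | forall j k,
    `|(n%:R^-1 *: (X^T *m (mx_at W w *m v k))) j 0| <=
    sigmas * Num.sqrt (2 * m2 * ln (2 * (p * #|K|)%:R / eps) / n%:R) * V].
Proof.
move=> K0 vV; have [ind _ sub _ _] := noise.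
pose zeta k i w := \sum_l W i l w * v k l 0.
have V0 : 0 <= V by have /card_gt0P[k _] := K0; rewrite -(vV k) lq_norm_ge0.
apply: prob_at_leastS
  (@subgaussian_average_maximal K zeta (sigmas * V) _ _ _ _ _).
- move=> w /= bound j k; have := bound j k; rewrite mulrAC !mxE.
  congr (`|_ * _| <= _); apply: eq_bigr => i _; rewrite !mxE; congr (_ * _).
  by apply: eq_bigr => l _; rewrite mxE.
- by [].
- exact: mulr_ge0.
- by move=> k i; apply: measurable_sum => l; exact: measurable_funM.
- move=> k; apply: (mutually_independent_functions ind) => i B mB.
  exact: sigma_algebra_of_lincomb.
- by move=> k i; rewrite -(vV k); exact: subgaussian_vector_lincomb.
Qed.

Lemma design_noise_vector_bound (v : 'cV[R]_p) :
  prob_at_least P (1 - eps) [set w |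
    `|n%:R^-1 *: (X^T *m (mx_at W w *m v))| <=
    delta1' n p sigmas m2 eps * lq_norm 2%:E v].
Proof.
have := @design_noise_maximal unit (fun=> v) _ _ (fun=> erefl).
rewrite card_unit muln1 => /(_ isT); apply: prob_at_leastS => w /= bound.
apply: mx_norm_le => [|j k]; last by rewrite ord1; exact: (bound j tt).
by rewrite /delta1' !mulr_ge0 ?sqrtr_ge0 ?powR_ge0.
Qed.

(** The columns of [W] are its products with the [p] basis vectors. *)
Lemma design_noise_matrix_bound :
  prob_at_least P (1 - eps) [set w |
    `|n%:R^-1 *: (X^T *m mx_at W w)| <=
    sigmas * Num.sqrt (2 * m2 * ln (2 * (p * p)%:R / eps) / n%:R)].
Proof.
have e1 (k : 'I_p) : lq_norm 2%:E (delta_mx k 0 : 'cV[R]_p) = 1.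
  rewrite lq_norm2E (bigD1 k)//= big1 ?addr0 ?mxE ?eqxx ?expr1n ?sqrtr1//.
  by move=> j jk; rewrite mxE (negbTE jk) expr0n.
have := @design_noise_maximal _ (fun k => delta_mx k 0) _ _ e1.
rewrite card_ord => /(_ p0); apply: prob_at_leastS => w /= bound.
apply: mx_norm_le => [|j k]; first by rewrite !mulr_ge0 ?sqrtr_ge0.
by have := bound j k; rewrite mulr1 mulmxA scalemxAl -colE mxE.
Qed.

End NoiseBounds.

Section Statistics.
Context {d : measure_display} {T : measurableType d} {R : realType}.
Variable P : probability T R.

Lemma measurable_bigmax (I : eqType) (s : seq I) (f : I -> T -> R) :
  (forall i, measurable_fun setT (f i)) ->
  measurable_fun setT (fun w => \big[Num.max/0]_(i <- s) f i w).
Proof.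
move=> mf; elim: s => [|i s IH].
  by under eq_fun do rewrite big_nil; exact: measurable_cst.
by under eq_fun do rewrite big_cons; exact: measurable_maxr.
Qed.

Lemma variance_statistics_bound (n p : nat) (cb cb' eps : R)
    (W : 'I_n -> 'I_p -> {RV P >-> R}) (hsigma2 : 'I_p -> {RV P >-> R}) :
  variance_statistics cb cb' W hsigma2 -> 0 < eps -> 1 <= cb' * p%:R / eps ->
  prob_at_least P (1 - eps) [set w | forall j,
    `|hsigma2 j w - noise_variance W j| <= b_level n p cb cb' eps].
Proof.
move=> stat eps0 ge1; apply/prob_at_leastP.
exists [set w | b_level n p cb cb' eps <=
  \big[Num.max/0]_(j < p) `|hsigma2 j w - noise_variance W j|]; split.
- rewrite -[X in measurable X]setTI; apply: measurable_fun_le => //.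
  apply: measurable_bigmax => j; apply: measurableT_comp => //.
  exact: measurable_funB.
- move=> w /= /existsNP[j /negP]; rewrite -ltNge => /ltW /le_trans; apply.
  exact: (le_bigmax _ (fun j => `|hsigma2 j w - noise_variance W j|) j).
- exact: stat.
Qed.

End Statistics.

(** * Absorbing the linear error term *)

(** Here [x] is [s `^ (- 1 / q)] times the [lq] norm of the error, [A] the [l1]
    norm of the error on the support and [G] the norm of its image under the
    Gram matrix. Since [lambda^-1 + lambda >= 2], the coefficients
    [lambda^-1] and [2 + lambda] of [A] add up to at most [2 * (lambda^-1 +
    lambda)]; with [A <= s * x] and the bound on [s] the terms in [A] are
    then at most [2 * M * c1 * x <= c * x / 2], half of the left-hand side
    of [c * x <= G]. *)
Lemma sensitivity_absorption (R : realType)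
    (c M c1 r lambda s N x A G mu tau E : R) :
  0 < c -> 0 <= M -> 0 <= r -> 0 < lambda -> 0 <= N -> 0 <= A -> 0 <= x ->
  mu <= M * r -> tau <= M * r -> E <= M * r ->
  4 * M * c1 <= c -> s * (lambda^-1 + lambda) * r <= c1 ->
  A <= s * x -> c * x <= G ->
  G <= 2 * (tau + mu * N) + mu * (lambda^-1 * A) + E * ((2 + lambda) * A) ->
  c * x <= 4 * M * r * (N + 1) /\ G <= 4 * M * r * (N + 1).
Proof.
move=> c0 M0 r0 l0 N0 A0 x0 muM tauM EM cM sr Asx cG GE.
have li0 : 0 < lambda^-1 by rewrite invr_gt0.
have l2 : 2 <= lambda^-1 + lambda.
  have : 0 <= lambda^-1 * (lambda - 1) ^+ 2 by rewrite mulr_ge0 ?sqr_ge0 ?ltW.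
  suff -> : lambda^-1 * (lambda - 1) ^+ 2 = lambda^-1 + lambda - 2 by lra.
  by field; rewrite gt_eqF.
have Mr0 : 0 <= M * r by exact: mulr_ge0.
have GA : G <= 2 * (M * r) * (N + 1) + M * r * (lambda^-1 + 2 + lambda) * A.
  have h1 : mu * N <= M * r * N by rewrite ler_wpM2r.
  have h2 : mu * (lambda^-1 * A) <= M * r * (lambda^-1 * A).
    by rewrite ler_wpM2r// mulr_ge0// ltW.
  have h3 : E * ((2 + lambda) * A) <= M * r * ((2 + lambda) * A).
    by rewrite ler_wpM2r// mulr_ge0//; lra.
  have -> : M * r * (lambda^-1 + 2 + lambda) * A =
    M * r * (lambda^-1 * A) + M * r * ((2 + lambda) * A) by ring.
  have -> : 2 * (M * r) * (N + 1) = 2 * (M * r * N) + 2 * (M * r) by ring.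
  lra.
have GA2 : M * r * (lambda^-1 + 2 + lambda) * A <= 2 * M * c1 * x.
  have h1 : M * r * (lambda^-1 + 2 + lambda) * A <=
      M * r * (2 * (lambda^-1 + lambda)) * (s * x).
    apply: ler_pM => //; first by rewrite mulr_ge0//; lra.
    by rewrite ler_wpM2l//; lra.
  apply: (le_trans h1).
  have -> : M * r * (2 * (lambda^-1 + lambda)) * (s * x) =
    2 * M * (s * (lambda^-1 + lambda) * r) * x by ring.
  by rewrite ler_wpM2r// ler_wpM2l// mulr_ge0.
have GA3 : 2 * M * c1 * x <= c * x / 2.
  have := ler_wpM2r x0 cM.
  have -> : 4 * M * c1 * x = 2 * (2 * M * c1 * x) by ring.
  lra.
split; lra.
Qed.

(** [Q] and [l1] are the [lq] and [l1] norms of the error, [pr] its prediction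
    error, [S = s `^ (1 / q)], [ht] the second component of the minimiser,
    and [A], [G] are as in [sensitivity_absorption], which bounds [x = Q /
    S] and [G]. The prediction error is then at most [G * (2 + lambda) * A
    <= G * 4 * s * x]. *)
Lemma error_bounds_arithmetic (R : realType)
    (kappa M c1 r lambda s S N A Q G l1 pr ht mu tau E : R) :
  0 < kappa -> 0 <= M -> 0 <= r -> 0 < lambda -> lambda <= 2 ->
  0 < S -> 0 < s -> 0 <= N -> 0 <= A -> 0 <= l1 -> 0 <= mu -> 0 <= E ->
  mu <= M * r -> tau <= M * r -> E <= M * r ->
  4 * M * c1 <= kappa -> s * (lambda^-1 + lambda) * r <= c1 ->
  lambda * ht <= lambda * N + A -> l1 <= (2 + lambda) * A ->
  G <= mu * ht + tau + (tau + mu * N) + E * l1 ->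
  A <= s * S^-1 * Q -> kappa * S^-1 * Q <= G -> pr <= G * l1 ->
  Q <= 4 * M / kappa * S * r * (N + 1) /\
  pr <= 64 * M ^+ 2 / kappa * s * r ^+ 2 * (N + 1) ^+ 2.
Proof.
move=> kappa0 M0 r0 l0 l2 S0 s0 N0 A0 l1_0 mu0 E0 muM tauM EM cM sr htA l1A GE.
rewrite -!mulrA; set x := S^-1 * Q => Asx xG prG.
have x0 : 0 <= x by rewrite -(pmulr_rge0 _ s0) (le_trans A0).
have li0 : 0 < lambda^-1 by rewrite invr_gt0.
have h_mu : mu * ht <= mu * N + mu * (lambda^-1 * A).
  rewrite -mulrDr ler_wpM2l// -(ler_pM2l l0) mulrDr mulrA divff ?gt_eqF//.
  by rewrite mul1r.
have h_E := ler_wpM2l E0 l1A.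
have GE' :
    G <= 2 * (tau + mu * N) + mu * (lambda^-1 * A) + E * ((2 + lambda) * A).
  by apply: (le_trans GE); lra.
have [xB GB] := sensitivity_absorption kappa0 M0 r0 l0 N0 A0 x0 muM tauM EM cM
  sr Asx xG GE'.
have QE : Q = S * x by rewrite mulrA divff ?mul1r// gt_eqF.
have x_le : x <= 4 * M * r * (N + 1) / kappa by rewrite ler_pdivlMr// mulrC.
split.
  rewrite (_ : 4 * _ = S * (4 * M * r * (N + 1) / kappa)); last first.
    by field; rewrite gt_eqF.
  by rewrite QE ler_pM2l.
have l1x : l1 <= 4 * (s * x).
  by apply: (le_trans l1A); apply: ler_pM => //; lra.
rewrite (_ : 64 * _ =
    4 * M * r * (N + 1)
    * (4 * (s * (4 * M * r * (N + 1) / kappa)))); last first.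
  by field; rewrite gt_eqF.
apply: (le_trans prG); apply: ler_pM => //.
  by apply: le_trans xG; rewrite mulr_ge0// ltW.
by apply: (le_trans l1x); rewrite ler_wpM2l// ler_wpM2l// ltW.
Qed.

(** * The estimator on the good event *)

Section Deterministic.
Context {R : realType} {n p : nat}.
Implicit Types (Psi : 'M[R]_p) (Delta theta : 'cV[R]_p) (J : {set 'I_p}).

Lemma lq_norm1_restrict J Delta :
  lq_norm 1%:E (Defs.restrict J Delta) = \sum_(j in J) `|Delta j 0|.
Proof.
rewrite lq_norm1E [RHS]big_mkcond/=; apply: eq_bigr => j _.
by rewrite mxE; case: ifP => // _; rewrite normr0.
Qed.

Lemma coneE J u Delta : cone J u Delta <->
  \sum_(j | j \notin J) `|Delta j 0| <= u * \sum_(j in J) `|Delta j 0|.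
Proof.
have -> : cone J u Delta = (lq_norm 1%:E (Defs.restrict (~: J)%SET Delta)
    <= u * lq_norm 1%:E (Defs.restrict J Delta)) :> Prop by [].
rewrite !lq_norm1_restrict.
by under eq_bigl do rewrite finset.inE.
Qed.

(** The cone is invariant under positive scaling, so [Delta] can be normalised
    to be a competitor in the infimum. *)
Lemma sensitivity_mul_le Psi q s u kappa J Delta :
  (1 <= q)%E -> (kappa%:E <= sensitivity Psi q s u)%E ->
  (#|J| <= s)%N -> cone J u Delta -> kappa * lq_norm q Delta <= `|Psi *m Delta|.
Proof.
move=> q1 kle Js cJ; have [N0|N_neq0] := eqVneq (lq_norm q Delta) 0.
  by rewrite N0 mulr0.
have Np : 0 < lq_norm q Delta by rewrite lt_def N_neq0 lq_norm_ge0.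
set a := (lq_norm q Delta)^-1; have a0 : 0 < a by rewrite invr_gt0.
rewrite -ler_pdivlMr// -/a -lee_fin; apply: (le_trans kle).
have NE : `|Psi *m Delta| * a = `|Psi *m (a *: Delta)|.
  by rewrite -scalemxAr normrZ gtr0_norm// mulrC.
have aE (A : {pred 'I_p}) :
    \sum_(j in A) `|(a *: Delta) j 0| = a * \sum_(j in A) `|Delta j 0|.
  by rewrite mulr_sumr; apply: eq_bigr => j _; rewrite mxE normrM gtr0_norm.
have caJ : cone J u (a *: Delta).
  apply/coneE; move/coneE: cJ => cJ.
  by rewrite (aE [predC J]) (aE J) mulrCA ler_pM2l.
have aN1 : lq_norm q (a *: Delta) = 1 by rewrite lq_normZ// gtr0_norm// mulVf.
rewrite NE.
pose S K := [set `|Psi *m D|%:E | D in [set D | cone K u D /\ lq_norm q D = 1]].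
apply: (@le_trans _ _ (ereal_inf (S J))).
  by apply: ereal_inf_lbound; exists J.
by apply: ereal_inf_lbound; exists (a *: Delta).
Qed.

(** Let [A], [B] be the [l1] norms of the error on the support [J] of [theta]
    and off it. As [theta] vanishes off [J], [|theta|_1 - |htheta|_1 <= A -
    B], and the comparison of objective values gives [B + lambda * (ht -
    |theta|_2) <= A]. The cone condition follows because [|theta|_2 - ht <=
    |theta|_2 - |htheta|_2 <= A]; it is here that the aperture is enlarged
    from [1] to [1 + lambda]. *)
Lemma support_cone (s : nat) theta htheta (lambda ht : R) : sparse s theta ->
  0 <= lambda -> lq_norm 2%:E htheta <= ht ->
  lq_norm 1%:E htheta + lambda * ht <=
    lq_norm 1%:E theta + lambda * lq_norm 2%:E theta ->
  exists2 J : {set 'I_p}, (#|J| <= s)%N &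
    [/\ cone J (1 + lambda) (htheta - theta)
      & lambda * ht <= lambda * lq_norm 2%:E theta
                       + \sum_(j in J) `|(htheta - theta) j 0|].
Proof.
move=> sp l0 ht_ge opt; pose J := [set j | theta j 0 != 0]%SET.
have Jout j : j \notin J -> theta j 0 = 0 by rewrite finset.inE negbK => /eqP.
exists J; first by rewrite cardsE.
set A := \sum_(j in J) `|(htheta - theta) j 0|.
set B := \sum_(j | j \notin J) `|(htheta - theta) j 0|.
have B0 : 0 <= B by exact: sumr_ge0.
have AE : A = \sum_(j in J) `|htheta j 0 - theta j 0|.
  by apply: eq_bigr => j _; rewrite !mxE.
have l1 : lq_norm 1%:E theta - lq_norm 1%:E htheta <= A - B.
  rewrite !lq_norm1E (bigID (mem J))/= [X in _ + X - _]big1; last first.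
    by move=> j /Jout ->; rewrite normr0.
  rewrite addr0 [X in _ - X](bigID (mem J))/= opprD addrA; apply: lerD.
    rewrite AE -sumrB; apply: ler_sum => j _.
    by rewrite (le_trans (lerB_dist _ _))// distrC.
  rewrite lerN2; apply: ler_sum => j /Jout tj.
  by rewrite !mxE tj subr0.
have l2 := lq_norm2_sub_le (u := theta) htheta Jout; rewrite -AE in l2.
have lA := ler_wpM2l l0 l2; have lht := ler_wpM2l l0 ht_ge.
have [cB cht] : B <= (1 + lambda) * A /\
    lambda * ht <= lambda * lq_norm 2%:E theta + A.
  move: opt l1 lA lht; clear -B0; clearbody A B.
  move: (lq_norm 1%:E theta) (lq_norm 1%:E htheta) => t1 h1.
  move: (lq_norm 2%:E theta) (lq_norm 2%:E htheta) => t2 h2.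
  by move=> *; split; lra.
by split=> //; apply/coneE.
Qed.

(** The left-hand side is the quadratic form of the Gram matrix at [Delta]. *)
Lemma prediction_norm_le (X : 'M[R]_(n, p)) Delta :
  n%:R^-1 * lq_norm 2%:E (X *m Delta) ^+ 2
    <= `|gram X *m Delta| * lq_norm 1%:E Delta.
Proof.
have -> : n%:R^-1 * lq_norm 2%:E (X *m Delta) ^+ 2
    = \sum_j Delta j 0 * (gram X *m Delta) j 0.
  rewrite lq_norm2E sqr_sqrtr; last by apply: sumr_ge0 => j _; exact: sqr_ge0.
  transitivity ((n%:R^-1 *: ((X *m Delta)^T *m (X *m Delta))) 0 0).
    by rewrite !mxE; congr (_ * _); apply: eq_bigr => i _; rewrite !mxE expr2.
  rewrite trmx_mul -mulmxA scalemxAr mxE; apply: eq_bigr => j _.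
  by rewrite mxE /gram -scalemxAl mulmxA.
rewrite lq_norm1E mulr_sumr; apply: ler_sum => j _.
apply: le_trans (ler_norm _) _; rewrite normrM mulrC ler_wpM2r//.
exact: ler_mx_norm.
Qed.

(* From here on the noise is fixed: [W] and [xi] are the values at one sample
   point, at which the bounds of the good event hold. *)
Variables (X W : 'M[R]_(n, p)) (xi : 'cV[R]_n) (theta : 'cV[R]_p).
Variables (hsigma2 sigma2 : 'I_p -> R).
Variables d1 d1' d2 d3 d4 d4' d5 b : R.

Local Notation c := (n%:R^-1 : R).
Local Notation N := (lq_norm 2%:E theta).
Local Notation WW := (W^T *m W).
Local Notation hD := (diag_mx (\row_j hsigma2 j)).
Local Notation D := (diag_mx (\row_j sigma2 j)).
Local Notation mu := (d1' + d4' + d5 + b).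
Local Notation tau := (d2 + d3).

Hypothesis bnd1 : `|c *: (X^T *m W)| <= d1.
Hypothesis bnd1' : `|c *: (X^T *m (W *m theta))| <= d1' * N.
Hypothesis bnd2 : `|c *: (X^T *m xi)| <= d2.
Hypothesis bnd3 : `|c *: (W^T *m xi)| <= d3.
Hypothesis bnd4 : `|c *: (WW - diag_part WW)| <= d4.
Hypothesis bnd4' : `|c *: ((WW - diag_part WW) *m theta)| <= d4' * N.
Hypothesis bnd5 : `|c *: diag_part WW - D| <= d5.
Hypothesis b0 : 0 <= b.
Hypothesis bndb : forall j, `|hsigma2 j - sigma2 j| <= b.

(** What is left of the estimating function at [v] when [X *m (v - theta)] is
    replaced by [0]: it is due to the noise alone, and [hD] compensates the bias
    of [W^T W / n]. *)
Definition noise_score (v : 'cV[R]_p) : 'cV[R]_p :=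
  c *: (X^T *m xi) + c *: (W^T *m xi) - c *: (X^T *m (W *m v))
  - (c *: WW - hD) *m v.

Lemma score_decomposition (v : 'cV[R]_p) :
  c *: ((X + W)^T *m ((X *m theta + xi) - (X + W) *m v)) + hD *m v =
  noise_score v - gram X *m (v - theta) - c *: (W^T *m X) *m (v - theta).
Proof.
rewrite /noise_score /gram.
have -> : X *m theta + xi - (X + W) *m v = xi - X *m (v - theta) - W *m v.
  rewrite mulmxDl mulmxBr; apply/matrixP => i j; rewrite !mxE; ring.
set u := v - theta.
rewrite mulmxBl [(X + W)^T]linearD/= mulmxDl !mulmxBr -!scalemxAl.
by rewrite -!mulmxA; apply/matrixP => i j; rewrite ![_ i j]mxE; ring.
Qed.

Lemma diag_mx_subE (u v : 'I_p -> R) :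
  diag_mx (\row_j u j) - diag_mx (\row_j v j) = diag_mx (\row_j (u j - v j)).
Proof. by rewrite -raddfB; congr diag_mx; apply/rowP => j; rewrite !mxE. Qed.

Let bndD : `|hD - D| <= b.
Proof.
rewrite diag_mx_subE; apply: mx_norm_le => // i j; rewrite !mxE.
by case: (i == j); rewrite ?mulr0n ?mulr1n ?normr0.
Qed.

(** [W^T W / n - hD] is split into its off-diagonal part, the fluctuation of its
    diagonal and the error of the variance statistics. A diagonal matrix
    multiplies the maximum norm by at most its largest entry, and that norm
    is at most the Euclidean one, whence the factor [N]. *)
Lemma noise_score_true_le : `|noise_score theta| <= tau + mu * N.
Proof.
have -> : noise_score theta = c *: (X^T *m xi) + c *: (W^T *m xi)
    - c *: (X^T *m (W *m theta)) - c *: ((WW - diag_part WW) *m theta)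
    - (c *: diag_part WW - D) *m theta + (hD - D) *m theta.
  rewrite /noise_score !mulmxBl -!scalemxAl.
  by apply/matrixP => i j; rewrite ![_ i j]mxE; ring.
have diagE : c *: diag_part WW - D = diag_mx (\row_j (c * WW j j - sigma2 j)).
  rewrite -diag_mx_subE /diag_part -linearZ/=.
  by congr (diag_mx _ - _); apply/rowP => j; rewrite !mxE.
have N_ge := mx_norm_le_lq_norm2 theta.
have t5 : `|(c *: diag_part WW - D) *m theta| <= d5 * N.
  move: bnd5; rewrite diagE => h.
  by apply: le_trans (diag_mx_norm_le _ _) _; exact: ler_pM.
have tb : `|(hD - D) *m theta| <= b * N.
  move: bndD; rewrite diag_mx_subE => h.
  by apply: le_trans (diag_mx_norm_le _ _) _; exact: ler_pM.
have -> : tau + mu * N = d2 + d3 + d1' * N + d4' * N + d5 * N + b * N.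
  by ring.
apply: le_trans (ler_normD _ _) (lerD _ tb).
apply: le_trans (ler_normB _ _) (lerD _ t5).
apply: le_trans (ler_normB _ _) (lerD _ bnd4').
apply: le_trans (ler_normB _ _) (lerD _ bnd1').
exact: le_trans (ler_normD _ _) (lerD bnd2 bnd3).
Qed.

(** The score is affine in [v], with a linear part whose entries are small; a
    matrix maps [l1] to the maximum norm with norm equal to its largest
    entry. *)
Lemma noise_score_sub_le (v : 'cV[R]_p) :
  `|noise_score v - noise_score theta|
    <= (d1 + d4 + d5 + b) * lq_norm 1%:E (v - theta).
Proof.
have -> : noise_score v - noise_score theta =
    - ((c *: (X^T *m W) + (c *: WW - hD)) *m (v - theta)).
  rewrite /noise_score [in RHS]mulmxDl !mulmxBr -!scalemxAl -!mulmxA.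
  by apply/matrixP => i j; rewrite ![_ i j]mxE; ring.
have -> : c *: WW - hD =
    c *: (WW - diag_part WW) + (c *: diag_part WW - D) - (hD - D).
  by rewrite scalerBr opprB !addrA !subrK.
rewrite normrN; apply: le_trans (mx_norm_mulmx_le _ _) _.
rewrite ler_wpM2r ?lq_norm_ge0// !addrA.
apply: le_trans (ler_normB _ _) (lerD _ bndD).
rewrite -[X in `|X| <= _]addrA.
apply: le_trans (ler_normD _ _) (lerD _ bnd5).
exact: le_trans (ler_normD _ _) (lerD bnd1 bnd4).
Qed.

Lemma true_parameter_feasible (Theta : set 'cV[R]_p) : Theta theta ->
  conic_feasible Theta (X + W) (X *m theta + xi) hD mu tau theta N.
Proof.
move=> Th; split=> //; first exact: lq_norm_ge0.
rewrite score_decomposition subrr !mulmx0 !subr0 addrC.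
exact: noise_score_true_le.
Qed.

(** [score_decomposition] is solved for the Gram term. The estimating function
    is at most [mu * ht + tau] by feasibility, and [d1] counts twice, once
    for [X^T W] in the score and once for [W^T X]. *)
Lemma gram_norm_le (Theta : set 'cV[R]_p) htheta ht :
  conic_feasible Theta (X + W) (X *m theta + xi) hD mu tau htheta ht ->
  `|gram X *m (htheta - theta)| <= mu * ht + tau + (tau + mu * N)
    + (2 * d1 + d4 + d5 + b) * lq_norm 1%:E (htheta - theta).
Proof.
move=> [_ _]; rewrite score_decomposition; set u := htheta - theta => res _.
have WX : `|c *: (W^T *m X) *m u| <= d1 * lq_norm 1%:E u.
  apply: le_trans (mx_norm_mulmx_le _ _) _.
  rewrite ler_wpM2r ?lq_norm_ge0//; apply: le_trans bnd1.
  apply: mx_norm_le => // i j.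
  rewrite -[W^T *m X]trmxK trmx_mul trmxK -linearZ mxE.
  exact: ler_mx_norm.
have Sv : `|noise_score htheta| <=
    (tau + mu * N) + (d1 + d4 + d5 + b) * lq_norm 1%:E u.
  rewrite -[noise_score htheta](subrK (noise_score theta)) addrC.
  apply: le_trans (ler_normD _ _) _.
  exact: lerD noise_score_true_le (noise_score_sub_le _).
have -> : gram X *m u = noise_score htheta - c *: (W^T *m X) *m u
    - (noise_score htheta - gram X *m u - c *: (W^T *m X) *m u).
  by apply/matrixP => i j; rewrite ![_ i j]mxE; ring.
have sumE (x y : R) : mu * ht + tau + (tau + mu * x)
    + (2 * d1 + d4 + d5 + b) * y =
    (tau + mu * x) + (d1 + d4 + d5 + b) * y + d1 * y + (mu * ht + tau) by ring.
rewrite sumE.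
apply: le_trans (ler_normB _ _) (lerD _ res).
exact: le_trans (ler_normB _ _) (lerD Sv WX).
Qed.

Lemma estimation_error_bounds (Theta : set 'cV[R]_p) htheta (ht lambda : R)
    (q : \bar R) (s : nat) (kappa c1 M r : R) :
  Theta theta -> (0 < s)%N -> sparse s theta -> (1 <= q)%E ->
  0 < lambda <= 2 ->
  conic_solution Theta (X + W) (X *m theta + xi) hD mu tau lambda htheta ht ->
  0 < kappa ->
  ((kappa * s%:R `^ (- inv_exponent q))%:E
     <= sensitivity (gram X) q s (1 + lambda))%E ->
  0 <= M -> 0 <= r -> 0 <= mu -> mu <= M * r -> tau <= M * r ->
  2 * d1 + d4 + d5 + b <= M * r ->
  4 * M * c1 <= kappa -> s%:R * (lambda^-1 + lambda) * r <= c1 ->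
  lq_norm q (htheta - theta)
    <= 4 * M / kappa * s%:R `^ inv_exponent q * r * (N + 1) /\
  n%:R^-1 * lq_norm 2%:E (X *m (htheta - theta)) ^+ 2
    <= 64 * M ^+ 2 / kappa * s%:R * r ^+ 2 * (N + 1) ^+ 2.
Proof.
move=> Th s0 sp q1 /andP[l0 l2] sol kappa0 sens M0 r0 mu0 muM tauM EM cM sr.
have thF := true_parameter_feasible Th.
have [feas opt] := sol (ex_intro _ theta (ex_intro _ N thF)).
have {}opt := opt _ _ thF.
have ht_ge : lq_norm 2%:E htheta <= ht by case: feas.
have [J Js [cJ htJ]] := support_cone sp (ltW l0) ht_ge opt.
have G := gram_norm_le feas.
have A_le := sum_normr_le_lq_norm (htheta - theta) q1 s0 Js.
have x_le := sensitivity_mul_le q1 sens Js cJ.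
have pred := prediction_norm_le X (htheta - theta).
have N0 : 0 <= N := lq_norm_ge0 _ _.
have l1_0 : 0 <= lq_norm 1%:E (htheta - theta) := lq_norm_ge0 _ _.
have sR : 0 < s%:R :> R by rewrite ltr0n.
have S0 : 0 < s%:R `^ (inv_exponent q) :> R by exact: powR_gt0.
have l1E : lq_norm 1%:E (htheta - theta)
    <= (2 + lambda) * \sum_(j in J) `|(htheta - theta) j 0|.
  have -> : 2 + lambda = 1 + (1 + lambda) by ring.
  rewrite mulrDl mul1r lq_norm1E (bigID (mem J))/= lerD2l.
  exact/coneE.
have A0 : 0 <= \sum_(j in J) `|(htheta - theta) j 0| by exact: sumr_ge0.
have E0 : 0 <= 2 * d1 + d4 + d5 + b.
  have d1_0 := le_trans (normr_ge0 _) bnd1.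
  have d4_0 := le_trans (normr_ge0 _) bnd4.
  have d5_0 := le_trans (normr_ge0 _) bnd5.
  by rewrite !addr_ge0// mulr_ge0.
rewrite powRN in A_le x_le.
exact: (error_bounds_arithmetic kappa0 M0 r0 l0 l2 S0 sR N0 A0 l1_0 mu0 E0
  muM tauM EM cM sr htJ l1E G A_le x_le pred).
Qed.

End Deterministic.

(** * Orders of magnitude of the noise levels *)

Lemma subexp_level_ge0 (R : realType) (n : nat) (g t x : R) :
  0 <= g -> 0 <= subexp_level n g t x.
Proof. by move=> g0; rewrite le_max mulr_ge0// sqrtr_ge0. Qed.

Section Levels.
Context {R : realType}.
Implicit Types g t x y : R.

Lemma expR1_le4 : expR 1 <= 4 :> R.
Proof.
have h : expR (2^-1) <= 2 :> R.
  rewrite -[leLHS]invrK -expRN invf_ple ?posrE ?expR_gt0//.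
  by apply: le_trans (expR_ge1Dx _); lra.
have {1}-> : (1 : R) = 2^-1 + 2^-1 by field.
rewrite expRD; have -> : 4 = 2 * 2 :> R by ring.
by apply: ler_pM => //; exact: expR_ge0.
Qed.

Lemma ln_ge1 x : 4 <= x -> 1 <= ln x.
Proof.
move=> x4; rewrite -(expRK 1) ler_ln ?posrE ?expR_gt0//; last by lra.
exact: le_trans expR1_le4 x4.
Qed.

Lemma ln2_le1 : ln 2 <= 1 :> R.
Proof.
rewrite -[leRHS]expRK ler_ln ?posrE ?expR_gt0//.
by apply: le_trans (expR_ge1Dx _); lra.
Qed.

Variables (n p : nat) (eps : R).
Hypotheses (n0 : (0 < n)%N) (p0 : (0 < p)%N).
Hypothesis eps0 : 0 < eps.

Local Notation L := (ln (p%:R / eps)).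
Local Notation r := (Num.sqrt (L / n%:R)).

Hypothesis eps8 : eps <= 8^-1.

Let P0 : 0 < p%:R :> R. Proof. by rewrite ltr0n. Qed.
Let P1 : 1 <= p%:R :> R. Proof. by rewrite ler1n. Qed.
Let N0 : 0 < n%:R :> R. Proof. by rewrite ltr0n. Qed.

Let eps1 : eps <= 1.
Proof. by apply: le_trans eps8 _; rewrite invf_le1// ler1n. Qed.

Let ratio_ge8 : 8 <= p%:R / eps.
Proof.
rewrite ler_pdivlMr//; apply: le_trans P1.
by rewrite mulrC -ler_pdivlMr// mul1r.
Qed.

Lemma log_ratio_ge1 : 1 <= L.
Proof. by apply: ln_ge1; apply: le_trans ratio_ge8; rewrite ler_nat. Qed.

Let L0 : 0 <= L. Proof. exact: le_trans log_ratio_ge1. Qed.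

Lemma log_level_vector : ln (2 * p%:R / eps) <= 2 * L.
Proof.
rewrite -mulrA lnM ?posrE ?divr_gt0//.
by have := ln2_le1; have := log_ratio_ge1; lra.
Qed.

(** For [p = 1] the logarithm is that of [0], which is [0]; otherwise its
    argument is at most the square of [p / eps]. *)
Lemma log_level_offdiag : ln (p%:R * (p%:R - 1) / eps) <= 2 * L.
Proof.
have [p1|p1] := eqVneq p 1%N.
  have -> : p%:R - 1 = 0 :> R by rewrite p1 subrr.
  by rewrite mulr0 mul0r ln0// mulr_ge0.
have p2 : 0 < p%:R - 1 :> R by rewrite subr_gt0 ltr1n ltn_neqAle eq_sym p1.
rewrite (_ : 2 * L = ln (p%:R / eps * (p%:R / eps))); last first.
  by rewrite [in RHS]lnM ?posrE ?divr_gt0//; ring.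
rewrite ler_ln ?posrE ?mulr_gt0 ?invr_gt0//.
rewrite mulrAC ler_wpM2l ?divr_ge0 ?(ltW eps0)//.
rewrite ler_pdivlMr//; have : eps * (p%:R - 1) <= 1 * (p%:R - 1).
  by rewrite ler_wpM2r ?(ltW p2).
by rewrite mulrC; lra.
Qed.

Lemma log_level_matrix : ln (2 * (p * p)%:R / eps) <= 3 * L.
Proof.
have -> : 2 * (p * p)%:R / eps = 2 * (p%:R * (p%:R / eps)).
  by rewrite natrM; field; rewrite gt_eqF.
rewrite lnM ?posrE ?mulr_gt0 ?invr_gt0// lnM ?posrE ?mulr_gt0 ?invr_gt0//.
have : ln p%:R <= L.
  rewrite ler_ln ?posrE ?divr_gt0// ler_pdivlMr//.
  by rewrite ler_piMr ?(ltW P0).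
by have := ln2_le1; have := log_ratio_ge1; lra.
Qed.

Lemma log_level_statistics cb' : 0 < cb' ->
  ln (cb' * p%:R / eps) <= (1 + `|ln cb'|) * L.
Proof.
move=> cb0; rewrite -mulrA lnM ?posrE ?divr_gt0// mulrDl mul1r addrC lerD2l.
apply: le_trans (ler_norm _) _; rewrite -[leLHS]mulr1.
by rewrite ler_wpM2l// log_ratio_ge1.
Qed.

Lemma sqrt_level_le k x : 1 <= k -> x <= k * L ->
  Num.sqrt (x / n%:R) <= k * r.
Proof.
move=> k1 xk; have k0 : 0 <= k by lra.
apply: le_trans (_ : Num.sqrt (k * (L / n%:R)) <= _).
  by rewrite ler_wsqrtr// mulrA ler_wpM2r// invr_ge0 ltW.
rewrite sqrtrM// ler_wpM2r ?sqrtr_ge0//.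
rewrite -[leRHS]ger0_norm// -sqrtr_sqr ler_wsqrtr// expr2.
by rewrite ler_peMr.
Qed.

Lemma sqrt_variance_level_le k m2 x : 1 <= k -> 0 <= m2 -> 2 * x <= k * L ->
  Num.sqrt (2 * m2 * x / n%:R) <= Num.sqrt m2 * (k * r).
Proof.
move=> k1 m20 xk; have -> : 2 * m2 * x / n%:R = m2 * (2 * x / n%:R) by ring.
by rewrite sqrtrM// ler_wpM2l ?sqrtr_ge0// sqrt_level_le.
Qed.

(** The linear branch of the level is of order [r ^+ 2], hence of order [r]. *)
Lemma subexp_level_le g t k x : 0 < g -> 0 < t -> r <= 1 ->
  1 <= k -> 2 * x <= k * L -> subexp_level n g t x <= k * (g + t^-1) * r.
Proof.
move=> g0 t0 r1 k1 xk; have r0 : 0 <= r by exact: sqrtr_ge0.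
have k0 : 0 <= k by lra.
have ti : 0 <= t^-1 by rewrite invr_ge0 ltW.
rewrite /subexp_level ge_max; apply/andP; split.
  have := ler_wpM2l (ltW g0) (sqrt_level_le k1 xk); move=> /le_trans; apply.
  by rewrite mulrCA mulrA ler_wpM2r// ler_wpM2l// lerDl.
have -> : 2 * x / (t * n%:R) = t^-1 * (2 * x / n%:R).
  by field; rewrite !gt_eqF.
apply: le_trans (_ : t^-1 * (k * r ^+ 2) <= _).
  rewrite ler_wpM2l// sqr_sqrtr ?divr_ge0 ?(ltW N0)// mulrA.
  by rewrite ler_wpM2r// invr_ge0 ltW.
have -> : k * (g + t^-1) * r = t^-1 * (k * r) + g * (k * r) by ring.
rewrite -[leLHS]addr0; apply: lerD; last by rewrite !mulr_ge0// ltW.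
by rewrite !ler_wpM2l// expr2 ler_piMr.
Qed.

Variables m2 sigma sigmas g0 s0 g2 s2 cb cb' : R.
Hypotheses (m20 : 0 <= m2) (sigma0 : 0 <= sigma) (sigmas0 : 0 <= sigmas).
Hypotheses (g0p : 0 < g0) (s0p : 0 < s0) (g2p : 0 < g2) (s2p : 0 < s2).
Hypotheses (cb0 : 0 < cb) (cb'0 : 0 < cb').

Local Notation a := (Num.sqrt m2).
Local Notation h0 := (g0 + s0^-1).
Local Notation h2 := (g2 + s2^-1).
Local Notation l := (1 + `|ln cb'|).

(** Each coefficient is large enough for the three sums below at once: twelve is
    twice the six of [delta1_le], and eight covers [delta4] and [delta5]
    together. *)
Definition level_constant : R :=
  1 + 4 * (sigma * a) + 12 * (sigmas * a) + 4 * h2 + 8 * h0 + cb * l.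

Let h0p : 0 < h0. Proof. by rewrite addr_gt0 ?invr_gt0. Qed.
Let h2p : 0 < h2. Proof. by rewrite addr_gt0 ?invr_gt0. Qed.
Let l1 : 1 <= l. Proof. by rewrite lerDl. Qed.

Let sa0 : 0 <= sigma * a. Proof. by rewrite mulr_ge0// sqrtr_ge0. Qed.
Let ssa0 : 0 <= sigmas * a. Proof. by rewrite mulr_ge0// sqrtr_ge0. Qed.
Let cbl0 : 0 <= cb * l.
Proof. by rewrite mulr_ge0 ?(ltW cb0)// addr_ge0. Qed.

Lemma level_constant_ge1 : 1 <= level_constant.
Proof. by rewrite /level_constant -!addrA lerDl !addr_ge0// mulr_ge0// ltW. Qed.

Hypothesis r1 : r <= 1.

Let r0 : 0 <= r. Proof. exact: sqrtr_ge0. Qed.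

Let vec4 : 2 * ln (2 * p%:R / eps) <= 4 * L.
Proof. by have := log_level_vector; move: (ln _) L => x y; lra. Qed.

Let off4 : 2 * ln (p%:R * (p%:R - 1) / eps) <= 4 * L.
Proof. by have := log_level_offdiag; move: (ln _) L => x y; lra. Qed.

Let mat6 : 2 * ln (2 * (p * p)%:R / eps) <= 6 * L.
Proof. by have := log_level_matrix; move: (ln _) L => x y; lra. Qed.

Let one_le4 : 1 <= 4 :> R. Proof. by rewrite ler1n. Qed.
Let one_le6 : 1 <= 6 :> R. Proof. by rewrite ler1n. Qed.

Lemma delta1'_le : delta1' n p sigmas m2 eps <= 4 * (sigmas * a) * r.
Proof.
have := ler_wpM2l sigmas0 (sqrt_variance_level_le one_le4 m20 vec4).
by rewrite (_ : 4 * _ * r = sigmas * (a * (4 * r)))//; ring.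
Qed.

Lemma delta1_le : sigmas * Num.sqrt (2 * m2 * ln (2 * (p * p)%:R / eps) / n%:R)
  <= 6 * (sigmas * a) * r.
Proof.
have := ler_wpM2l sigmas0 (sqrt_variance_level_le one_le6 m20 mat6).
by rewrite (_ : 6 * _ * r = sigmas * (a * (6 * r)))//; ring.
Qed.

Lemma delta2_le : delta2 n p sigma m2 eps <= 4 * (sigma * a) * r.
Proof.
have := ler_wpM2l sigma0 (sqrt_variance_level_le one_le4 m20 vec4).
by rewrite (_ : 4 * _ * r = sigma * (a * (4 * r)))//; ring.
Qed.

Lemma delta3_le : delta3 n p g0 s0 eps <= 4 * h0 * r.
Proof. exact: subexp_level_le. Qed.

Lemma delta4_le : delta4 n p g0 s0 eps <= 4 * h0 * r.
Proof. exact: subexp_level_le. Qed.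

Lemma delta4'_le : delta4' n p g2 s2 eps <= 4 * h2 * r.
Proof. exact: subexp_level_le. Qed.

Lemma b_level_le : b_level n p cb cb' eps <= cb * l * r.
Proof.
rewrite -mulrA ler_wpM2l ?(ltW cb0)// sqrt_level_le//.
exact: log_level_statistics.
Qed.

Let nonneg_terms : [/\ 0 <= sigma * a * r, 0 <= sigmas * a * r, 0 <= h0 * r,
  0 <= h2 * r & 0 <= cb * l * r].
Proof. by split; rewrite mulr_ge0// ltW. Qed.

Lemma mu_level_le : delta1' n p sigmas m2 eps + delta4' n p g2 s2 eps
  + delta5 n p g0 s0 eps + b_level n p cb cb' eps <= level_constant * r.
Proof.
have := lerD (lerD (lerD delta1'_le delta4'_le) delta3_le) b_level_le.
move=> /le_trans; apply; have [] := nonneg_terms.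
rewrite /level_constant; move: (sigma * a) (sigmas * a) h0 h2 (cb * l) r r0.
by move=> *; lra.
Qed.

Lemma tau_level_le : delta2 n p sigma m2 eps + delta3 n p g0 s0 eps
  <= level_constant * r.
Proof.
have := lerD delta2_le delta3_le.
move=> /le_trans; apply; have [] := nonneg_terms.
rewrite /level_constant; move: (sigma * a) (sigmas * a) h0 h2 (cb * l) r r0.
by move=> *; lra.
Qed.

Lemma error_level_le :
  2 * (sigmas * Num.sqrt (2 * m2 * ln (2 * (p * p)%:R / eps) / n%:R))
  + delta4 n p g0 s0 eps + delta5 n p g0 s0 eps + b_level n p cb cb' eps
  <= level_constant * r.
Proof.
have d1 := ler_wpM2l (ler0n R 2) delta1_le.
have := lerD (lerD (lerD d1 delta4_le) delta3_le) b_level_le.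
move=> /le_trans; apply; have [] := nonneg_terms.
rewrite /level_constant; move: (sigma * a) (sigmas * a) h0 h2 (cb * l) r r0.
by move=> *; lra.
Qed.

Lemma mu_level_ge0 : 0 <= delta1' n p sigmas m2 eps + delta4' n p g2 s2 eps
  + delta5 n p g0 s0 eps + b_level n p cb cb' eps.
Proof.
rewrite !addr_ge0 ?subexp_level_ge0 ?(ltW g0p) ?(ltW g2p)//.
  by rewrite mulr_ge0 ?sqrtr_ge0.
by rewrite mulr_ge0 ?sqrtr_ge0// ltW.
Qed.

End Levels.

(** * Oracle bounds for the conic programming estimator *)

Theorem theorem1 (R : realType) (gamma0 t0 : R -> R -> R) (gamma2 t2 : R -> R)
    (hconst : noise_constants gamma0 t0 gamma2 t2)
    (m2 sigma sigmas cb cb' c : R)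
    (hsigma : 0 <= sigma) (hsigmas : 0 <= sigmas)
    (hcb : 0 < cb) (hcb' : 0 < cb') (hc : 0 < c) :
  exists C c' c1max : R, [/\ 0 < C, 0 < c', 0 < c1max &
  forall (d : measure_display) (T : measurableType d) (P : probability T R)
    (n p s : nat) (X : 'M[R]_(n, p)) (theta : 'cV[R]_p)
    (W : 'I_n -> 'I_p -> {RV P >-> R}) (xi : 'I_n -> {RV P >-> R})
    (hsigma2 : 'I_p -> {RV P >-> R}) (Theta : set 'cV[R]_p)
    (eps lambda c1 : R) (q : \bar R)
    (htheta : T -> 'cV[R]_p) (ht : T -> R),
  (0 < n)%N ->
  max_col_mean_square X = m2 ->
  regression_noise sigma xi ->
  design_noise sigmas W xi ->
  variance_statistics cb cb' W hsigma2 ->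
  (1 <= s <= p)%N -> sparse s theta -> Theta theta ->
  0 < eps < 1 -> 1 <= cb' * p%:R / eps ->
  (1%:E <= q)%E ->
  2^-1 <= lambda <= 2 ->
  let mu := delta1' n p sigmas m2 eps
            + delta4' n p (gamma2 sigmas) (t2 sigmas) eps
            + delta5 n p (gamma0 sigma sigmas) (t0 sigma sigmas) eps
            + b_level n p cb cb' eps in
  let tau := delta2 n p sigma m2 eps
             + delta3 n p (gamma0 sigma sigmas) (t0 sigma sigmas) eps in
  (forall w, conic_solution Theta (X + mx_at W w) (X *m theta + vec_at xi w)
     (diag_mx (\row_j hsigma2 j w)) mu tau lambda (htheta w) (ht w)) ->
  ((c * s%:R `^ (- inv_exponent q))%:E
     <= sensitivity (gram X) q s (1 + lambda))%E ->
  0 < c1 <= c1max ->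
  s%:R <= c1 * (lambda^-1 + lambda)^-1 * Num.sqrt (n%:R / ln (p%:R / eps)) ->
  prob_at_least P (1 - 8 * eps) [set w |
    lq_norm q (htheta w - theta)
      <= C * s%:R `^ inv_exponent q * Num.sqrt (ln (c' * p%:R / eps) / n%:R)
           * (lq_norm 2%:E theta + 1)] /\
  prob_at_least P (1 - 8 * eps) [set w |
    n%:R^-1 * lq_norm 2%:E (X *m (htheta w - theta)) ^+ 2
      <= C * s%:R * (ln (c' * p%:R / eps) / n%:R)
           * (lq_norm 2%:E theta + 1) ^+ 2]].
Proof.
have [g0p s0p g2p s2p noise_bounds] := hconst _ _ hsigma hsigmas.
set g0 := gamma0 sigma sigmas in g0p noise_bounds *.
set s0 := t0 sigma sigmas in s0p noise_bounds *.
set g2 := gamma2 sigmas in g2p noise_bounds *.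
set s2 := t2 sigmas in s2p noise_bounds *.
pose M := level_constant m2 sigma sigmas g0 s0 g2 s2 cb cb'.
have M0 : 0 < M by apply: (lt_le_trans ltr01); exact: level_constant_ge1.
pose C1 := 4 * M / c; pose C2 := 64 * M ^+ 2 / c.
have C1p : 0 < C1 by rewrite divr_gt0// mulr_gt0.
have C2p : 0 < C2 by rewrite divr_gt0// mulr_gt0// exprn_gt0.
exists (C1 + C2), 1, (Num.min 1 (c / (4 * M))); split.
- exact: addr_gt0.
- by [].
- by rewrite lt_min ltr01 divr_gt0// mulr_gt0.
move=> d T P n p s X theta W xi hsigma2 Theta eps lambda c1 q htheta ht.
move=> n0 m2E xiN WN stat /andP[s_gt0 sp] spth Th eps01 cb_ge1 q1 /andP[l1 l2].
move=> mu tau sol sens /andP[c1_gt0 c1_le] s_le.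
have [eps0 eps_lt1] := andP eps01.
have p0 : (0 < p)%N := leq_trans s_gt0 sp.
have [eps8|eps8] := leP eps 8^-1; last first.
  have eps_le : 1 - 8 * eps <= 0.
    by rewrite subr_le0 -ler_pdivrMl// mulr1 ltW.
  by split; exact: prob_at_least_le0.
have m20 : 0 <= m2 by rewrite -m2E; exact: max_col_mean_square_ge0.
have lambda0 : 0 < lambda by apply: lt_le_trans l1; rewrite invr_gt0.
have nR : 0 < n%:R :> R by rewrite ltr0n.
rewrite mul1r; set L := ln (p%:R / eps) in s_le *.
have L0 : 0 < L := lt_le_trans ltr01 (log_ratio_ge1 p0 eps0 eps8).
set r := Num.sqrt (L / n%:R); have r0 : 0 <= r := sqrtr_ge0 _.
have ll0 : 0 < lambda^-1 + lambda by rewrite addr_gt0// invr_gt0.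
have [c1_le1 c1M] : c1 <= 1 /\ 4 * M * c1 <= c.
  move: c1_le; rewrite le_min => /andP[-> c1M]; split=> //.
  by rewrite mulrC -ler_pdivlMr// mulr_gt0.
have sr : s%:R * (lambda^-1 + lambda) * r <= c1.
  have inv1 : Num.sqrt (n%:R / L) * r = 1.
    rewrite -sqrtrM ?divr_ge0 ?(ltW L0)//.
    by rewrite mulrA divfK ?gt_eqF// divff ?gt_eqF// sqrtr1.
  have := ler_wpM2r (mulr_ge0 (ltW ll0) r0) s_le.
  rewrite mulrA => /le_trans; apply.
  rewrite [leLHS](_ : _ = c1 * ((lambda^-1 + lambda)^-1 * (lambda^-1 + lambda))
    * (Num.sqrt (n%:R / L) * r)); last by ring.
  by rewrite inv1 mulVf ?gt_eqF// !mulr1.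
have r1 : r <= 1.
  apply: le_trans c1_le1; apply: le_trans sr; rewrite ler_peMl//.
  have ll1 : 1 <= lambda^-1 + lambda.
    (* both summands are at least [1 / 2] *)
    have -> : 1 = 2^-1 + 2^-1 :> R by field.
    by rewrite lerD// lef_pV2 ?posrE.
  by rewrite mulr_ege1// ler1n.
have [E3 E4 E5 E4'] := noise_bounds d T P n p W xi theta eps n0 p0 eps01 xiN WN.
have E2 := design_response_noise_bound X p0 eps01 hsigma xiN.
have E1' := design_noise_vector_bound X p0 eps01 hsigmas WN theta.
have E1 := design_noise_matrix_bound X p0 eps01 hsigmas WN.
rewrite m2E in E2 E1' E1.
have Eb := variance_statistics_bound stat eps0 cb_ge1.
have b0 : 0 <= b_level n p cb cb' eps by rewrite mulr_ge0 ?sqrtr_ge0// ltW.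
have errors : prob_at_least P (1 - 8 * eps) [set w |
    lq_norm q (htheta w - theta)
      <= C1 * s%:R `^ inv_exponent q * r * (lq_norm 2%:E theta + 1) /\
    n%:R^-1 * lq_norm 2%:E (X *m (htheta w - theta)) ^+ 2
      <= C2 * s%:R * r ^+ 2 * (lq_norm 2%:E theta + 1) ^+ 2].
  (* eight events, each of which fails with probability at most [eps] *)
  have := prob_at_leastI (prob_at_leastI (prob_at_leastI E1 E1')
    (prob_at_leastI E2 E3)) (prob_at_leastI (prob_at_leastI E4 E4')
    (prob_at_leastI E5 Eb)).
  rewrite (_ : eps + eps + (eps + eps) + _ = 8 * eps); last by ring.
  apply: prob_at_leastS => w [[[B1 B1'] [B2 B3]] [[B4 B4'] [B5 Bb]]].
  have lambda02 : 0 < lambda <= 2 by rewrite lambda0.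
  apply: (estimation_error_bounds B1 B1' B2 B3 B4 B4' B5 b0 Bb Th s_gt0 spth q1
    lambda02 (sol w) hc sens (ltW M0) r0 _ _ _ _ c1M sr).
  - exact: mu_level_ge0.
  - exact: mu_level_le.
  - exact: tau_level_le.
  - exact: error_level_le.
have N0 : 0 <= lq_norm 2%:E theta + 1 by rewrite addr_ge0// lq_norm_ge0.
have S0 : 0 <= s%:R `^ inv_exponent q :> R := powR_ge0 _ _.
have widen (K x y z : R) : 0 <= x -> 0 <= y -> 0 <= z -> K <= C1 + C2 ->
    K * x * y * z <= (C1 + C2) * x * y * z by move=> *; rewrite !ler_wpM2r.
split; apply: prob_at_leastS errors => w [estim pred].
  by apply: (le_trans estim); apply: widen => //; rewrite lerDl ltW.
have <- : r ^+ 2 = L / n%:R by rewrite sqr_sqrtr// divr_ge0 ?(ltW L0).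
apply: (le_trans pred); apply: widen; rewrite ?exprn_ge0//.
by rewrite lerDr ltW.
Qed.
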